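(* Let $q$ be a prime power, let $k\ge 2$, and let $2\le d_1\le d_2\le\dots\le d_{k-1}$ be integers. Let $X=\{P_1,\dots,P_n\}\subseteq\mathbb{P}^{k-1}(\mathbb{F}_q)$ be the set of points of a zero-dimensional reduced complete intersection defined over $\mathbb{F}_q$ of degrees $d_1,\dots,d_{k-1}$. Let $\mathcal{C}\subseteq\mathbb{F}_q^n$ be the linear code obtained by evaluating the set of homogeneous linear forms in $\mathbb{F}_q[x_1,\dots,x_k]$ at the points of $X$, and suppose that $\dim_{\mathbb{F}_q}\mathcal{C}=k$. Then, for every integer $r$ with $1\le r\le k-1$, the $r$-th generalized Hamming weight of $\mathcal{C}$ satisfies $$\mathrm{d}_r(\mathcal{C})\ \ge\ (d_1\cdots d_r-1)\,d_{r+1}\cdots d_{k-1},$$ where the empty product (when $r=k-1$) equals $1$.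
   Context: A linear code over $\mathbb{F}_q$ is a linear subspace $\mathcal{C}\subseteq\mathbb{F}_q^n$. For a subcode (linear subspace) $\mathcal{D}\subseteq\mathcal{C}$, its support is $\mathrm{supp}(\mathcal{D})=\{i:\exists c\in\mathcal{D}\text{ with }c_i\ne 0\}$. The $r$-th generalized Hamming weight of $\mathcal{C}$ is $\mathrm{d}_r(\mathcal{C})=\min\{|\mathrm{supp}(\mathcal{D})|:\mathcal{D}\text{ is a subcode of }\mathcal{C}\text{ with }\dim_{\mathbb{F}_q}\mathcal{D}=r\}$. Let $\overline{\mathbb{F}}_q$ be an algebraic closure of $\mathbb{F}_q$. A complete intersection of degrees $d_1,\dots,d_t$ in $\mathbb{P}^{k-1}(\overline{\mathbb{F}}_q)$ is the subscheme defined by a regular sequence of homogeneous forms of degrees $d_1,\dots,d_t$ in $\overline{\mathbb{F}}_q[x_1,\dots,x_k]$; it is reduced if the ideal generated by the regular sequence is radical (i.e. equals the vanishing ideal of its zero locus). Thus ''the set of points $X$ of a zero-dimensional reduced complete intersection defined over $\mathbb{F}_q$ of degrees $d_1,\dots,d_{k-1}$'' means: there are homogeneous $f_1,\dots,f_{k-1}\in\mathbb{F}_q[x_1,\dots,x_k]$ with $\deg f_i=d_i$, forming a regular sequence in $\overline{\mathbb{F}}_q[x_1,\dots,x_k]$ and generating a radical ideal there, whose common zero locus in $\mathbb{P}^{k-1}(\overline{\mathbb{F}}_q)$ is exactly the set $X$ of (pairwise distinct) points, all of which lie in $\mathbb{P}^{k-1}(\mathbb{F}_q)$. Evaluation at the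 points of $X$: fix a representative $v_i\in\mathbb{F}_q^k\setminus\{0\}$ of each $P_i$; the code obtained by evaluating linear forms at $X$ is the image of the map $f\mapsto(f(v_1),\dots,f(v_n))$ from the $\mathbb{F}_q$-vector space of homogeneous polynomials of degree $1$ in $\mathbb{F}_q[x_1,\dots,x_k]$ (together with $0$) to $\mathbb{F}_q^n$. A different choice of representatives rescales coordinates by nonzero scalars and does not change the generalized Hamming weights. *)

(* Defs.v *)
From HB Require Import structures.
From mathcomp Require Import all_boot all_order all_algebra.
From mathcomp Require Export mpoly.

Set Implicit Arguments.
Unset Strict Implicit.
Unset Printing Implicit Defensive.

Import GRing.Theory.
Local Open Scope ring_scope.

(* Subspaces of F^n are finitely many, as they are encoded by n x n matrices. *)
Section FiniteSubspaces.
Import VectorInternalTheory.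
HB.instance Definition _ (F : finFieldType) (n : nat) :=
  [Countable of {vspace 'rV[F]_n} by <:].
HB.instance Definition _ (F : finFieldType) (n : nat) :=
  [Finite of {vspace 'rV[F]_n} by <:].
End FiniteSubspaces.

Section Codes.

Variables (F : finFieldType) (n : nat).
Implicit Types C D : {vspace 'rV[F]_n}.

Definition supp D : {set 'I_n} :=
  [set i | [exists c : 'rV[F]_n, (c \in D) && (c 0 i != 0)]].

(* The neutral element n bounds every support size, so it affects the minimum *)
(* only when C has no subcode of dimension r, that is when r > \dim C.        *)
Definition ghw C (r : nat) : nat :=
  \big[minn/n]_(D : {vspace 'rV[F]_n} | (D <= C)%VS && (\dim D == r)) #|supp D|.

End Codes.

Section Ideals.

Variables (R : comNzRingType) (m : nat).
Implicit Type f : 'I_m -> R.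

(* The ideal generated by the f_i such that P i; it is 0 if there are none. *)
Definition in_ideal (P : pred 'I_m) f (g : R) : Prop :=
  exists h : 'I_m -> R, g = \sum_(i | P i) h i * f i.

(* Each f_i is a non-zero-divisor modulo the previous ones, and the whole     *)
(* sequence generates a proper ideal.                                         *)
Definition regular_seq f : Prop :=
  (forall (i : 'I_m) (g : R),
     in_ideal (fun j => (j < i)%N) f (f i * g) ->
     in_ideal (fun j => (j < i)%N) f g)
  /\ ~ in_ideal predT f 1.

Definition generates_radical f : Prop :=
  forall (g : R) (e : nat), in_ideal predT f (g ^+ e) -> in_ideal predT f g.

End Ideals.

Definition is_algebraic_closure (F : fieldType) (K : closedFieldType)
    (iota : {rmorphism F -> K}) : Prop :=
  forall x : K, algebraicOver iota x.

(* Equality of the projective points represented by u and w. *)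
Definition proj_eq (K : fieldType) (k : nat) (u w : 'rV[K]_k) : Prop :=
  exists2 c : K, c != 0 & u = c *: w.

Definition evalpt (R : comNzRingType) (k : nat) (x : 'rV[R]_k)
    (p : {mpoly R[k]}) : R := p.@[fun i => x 0 i].

(* v lists representatives of pairwise distinct rational points. *)
Definition distinct_points (F : fieldType) (k n : nat)
    (v : 'I_n -> 'rV[F]_k) : Prop :=
  (forall j, v j != 0) /\ (forall i j, proj_eq (v i) (v j) -> i = j).

(* The points represented by v are exactly the zero locus, over K, of a       *)
(* reduced complete intersection of degrees d_i defined over F.               *)
Definition reduced_complete_intersection (F : fieldType) (K : closedFieldType)
    (iota : {rmorphism F -> K}) (k m n : nat) (d : 'I_m -> nat)
    (v : 'I_n -> 'rV[F]_k) : Prop :=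
  exists f : 'I_m -> {mpoly F[k]},
    let fK := fun i => map_mpoly iota (f i) in
    [/\ forall i, f i \is (d i).-homog,
        regular_seq fK,
        generates_radical fK
      & forall x : 'rV[K]_k, x != 0 ->
          (forall i, evalpt x (fK i) = 0) <->
          (exists j, proj_eq x (map_mx iota (v j)))].

(* C is the image of the space of linear forms (0 included, as 0 is d.-homog  *)
(* for all d) under evaluation at the v_j.                                    *)
Definition linear_forms_code (F : finFieldType) (k n : nat)
    (v : 'I_n -> 'rV[F]_k) (C : {vspace 'rV[F]_n}) : Prop :=
  forall c : 'rV[F]_n,
    c \in C <->
    (exists2 p : {mpoly F[k]}, p \is 1.-homog & c = \row_j evalpt (v j) p).

(* Main.v *)
Require Import Defs.
From mathcomp Require Import all_boot all_order all_algebra zify ring.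
From Stdlib Require Import Classical.

Set Implicit Arguments.
Unset Strict Implicit.
Unset Printing Implicit Defensive.

Import GRing.Theory.
Local Open Scope ring_scope.

(** An [r]-dimensional subcode consists of the evaluations of an [r]-dimensional
    space of linear forms, and a coordinate is outside its support exactly when
    the point lies in the linear space [L] of codimension [r] where these forms
    vanish. So the weight is [n] minus the number of points of [X] in [L], and the
    bound follows from two facts:
    - [n >= d_1 ... d_(k-1)]  ([card_points_geq]);
    - [X] has at most [d_(r+1) ... d_(k-1)] points in [L]  ([card_linear_section]).
    Both come from comparing dimensions of spaces of polynomials of degree at most
    [M], for all [M] at once. If [F_1, ..., F_k] have degrees [e_1, ..., e_k], the
    number [W(M)] of products [F ^ b] of degree at most [M] is, up to a shift of
    [M], the number of monomials of degree at most [M] divided by [e_1 ... e_k]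
    ([card_monomials_leq_weighted], [weighted_leq_card_monomials]). As [W] grows
    polynomially, an inequality [a * W(M) <= b * W(M + c)] for all [M] forces
    [a <= b] ([leq_of_poly_growth]).

    Forms vanishing on [X] are in the ideal [I] of the complete intersection. As
    [I] is radical, this is a matter of putting a power of such a form [g] in [I]
    ([homogeneous_nullstellensatz]). A variable, [g] and the regular sequence are
    one polynomial too many to be algebraically independent, and a relation on a
    regular sequence has a coefficient in the ideal that it generates
    ([regular_seq_relation]): thus each variable is algebraic over [g] modulo [I].
    Hence the ideal [I + (g - c)], for a general scalar [c], has a zero if it is
    proper ([proper_ideal_zero]). A zero would be a point of [X] where [g] does not
    vanish, so [g - c] is invertible modulo [I], and [I] being graded, [g] is
    nilpotent modulo [I].

    The first fact follows: in each degree, forms modulo [I] are spanned by [n]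
    elements, so that the products of these by the [f ^ b] span all forms.

    The second fact rests on a bound for nonsingular zeros
    ([card_nonsingular_zeros]): [k] polynomials [F_l] in [k] variables have at most
    [e_1 ... e_k] common zeros with an invertible Jacobian matrix, whatever their
    other zeros. Indeed, if [G_i] vanishes at all these zeros but the [i]-th one,
    the products [G_i * F ^ b] are linearly independent, because the [F_l] are local
    coordinates at each of the zeros. On [L], this is applied to the equations of
    [L], an affine chart, and [k - 1 - r] combinations of the [f_i]. The gradients
    of the [f_i] at a point of [X] have maximal rank because [I] is radical
    ([gradients_span]), hence generic combinations work at all the points of [X]
    in [L] ([generic_completion]); since the [j]-th of these only involves
    [f_1, ..., f_(r+j)], its degree can be taken to be [d_(r+j)]. *)

(** * Counting monomials by weight *)

Lemma exp_gt_poly (a b k : nat) : exists s, ((a * s + b) ^ k < 2 ^ s)%N.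
Proof.
(* With s = 2 ^ (2 x), it is enough that k (2 x + v) < (x + 1) ^ 2. *)
pose v := (a + b)%N; pose x := (2 * k + v * k)%N.
exists (2 ^ (x + x))%N.
have le1 : (a * 2 ^ (x + x) + b <= 2 ^ (x + x + v))%N.
  rewrite [leqRHS]expnD mulnC.
  apply: (@leq_trans (2 ^ (x + x) * v)%N); last first.
    by rewrite leq_mul2l ltnW ?orbT // ltn_expl.
  by rewrite mulnDr leq_add2l leq_pmull // expn_gt0.
have le2 : (x.+1 * x.+1 <= 2 ^ (x + x))%N.
  by rewrite expnD leq_mul // ltn_expl.
apply: (@leq_ltn_trans ((2 ^ (x + x + v)) ^ k)%N).
  by case: (k) => // k'; rewrite leq_exp2r.
rewrite -expnM ltn_exp2l //; apply: leq_trans le2.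
have le3 : (v * k <= x)%N by rewrite leq_addl.
have le4 : (2 * k * x <= x * x)%N by rewrite leq_mul2r leq_addr orbT.
by nia.
Qed.

Lemma bernoulli_nat b : (2 * b ^ b <= b.+1 ^ b)%N \/ b = 0%N.
Proof.
have key n : (b ^ n * (b + n) <= b * b.+1 ^ n)%N.
  elim: n => [|n IH]; first by rewrite !expn0 addn0 muln1 mul1n.
  rewrite !expnS mulnCA; apply: leq_trans (_ : b.+1 * (b ^ n * (b + n)) <= _)%N.
    by nia.
  by rewrite leq_mul2l IH orbT.
case: b key => [|b] key; [by right | left].
rewrite -(leq_pmul2l (ltn0Sn b)); apply: leq_trans (key b.+1).
by move: (b.+1 ^ b.+1)%N => t; nia.
Qed.

(** With [a > b], the sequence [w (j * c)] would grow at least like [(a / b) ^ j],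
    against the polynomial bound. *)
Lemma leq_of_poly_growth (w : nat -> nat) (a b c k : nat) :
    (forall M, (a * w M <= b * w (M + c))%N) -> (0 < w 0)%N ->
    (forall M, (w M <= M.+1 ^ k)%N) ->
  (a <= b)%N.
Proof.
move=> wab w0 wk; rewrite leqNgt; apply/negP => ltba.
have iter_wab j : (a ^ j * w 0 <= b ^ j * w (j * c))%N.
  elim: j => [|j IH]; first by rewrite !mul1n.
  rewrite !expnS -mulnA; apply: (@leq_trans (a * (b ^ j * w (j * c))))%N.
    by rewrite leq_mul2l IH orbT.
  by rewrite mulnCA [leqRHS]mulnAC [leqRHS]mulnC leq_mul2l mulSn addnC wab orbT.
have [le2b|b0] := bernoulli_nat b; last first.
  by have := wab 0%N; rewrite b0 mul0n leqNgt muln_gt0 w0 andbT -b0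
    (leq_ltn_trans _ ltba).
(* Every b steps, the growth is at least by the factor (1 + 1 / b) ^ b >= 2. *)
have [s lts] := exp_gt_poly (b * c) 1 k.
suff : (2 ^ s <= (b * c * s + 1) ^ k)%N by rewrite leqNgt lts.
have b_gt0 : (0 < b)%N.
  by case: (b) ltba le2b wab => // ltba _ /(_ 0%N); rewrite mul0n leqn0; nia.
rewrite -(@leq_pmul2l (b ^ (b * s))) ?expn_gt0 ?b_gt0 //.
apply: (@leq_trans (a ^ (b * s) * w 0)); last first.
  apply: leq_trans (iter_wab _) _; rewrite leq_mul2l (leq_trans (wk _)) ?orbT //.
  by rewrite addn1 mulnAC leqnn.
apply: (@leq_trans (a ^ (b * s))); last by rewrite leq_pmulr.
rewrite mulnC !expnM -expnMn.
case: (s) => // s'; rewrite leq_exp2r //; apply: leq_trans le2b _.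
by rewrite leq_exp2r.
Qed.

(** If [F_i] has degree [e i], these are the [b] for which the product of the
    [F_i ^+ b_i] has degree at most [M]. The type loses none of them when the
    weights are positive. *)
Definition weighted_exponents (k : nat) (e : 'I_k -> nat) (M : nat) :
    {set 'X_{1..k < M.+1}} :=
  [set b : 'X_{1..k < M.+1} | (\sum_i e i * (b : 'X_{1..k}) i <= M)%N].

Lemma card_monomials_leq (k M : nat) : (#|{: 'X_{1..k < M.+1}}| <= M.+1 ^ k)%N.
Proof.
pose f (m : 'X_{1..k < M.+1}) := [ffun i => inord (m i) : 'I_M.+1].
have f_inj : injective f.
  move=> m1 m2 /ffunP eqf; apply/val_inj/mnmP => i.
  have bnd (m : 'X_{1..k < M.+1}) : (m i < M.+1)%N.
    rewrite (leq_ltn_trans _ (bmdeg m)) // mdegE (bigD1 i) //=.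
    by rewrite leq_addr.
  have := congr1 val (eqf i); rewrite !ffunE /=.
  by rewrite !(@inordK M) //; exact: bnd.
by have := leq_card f f_inj; rewrite card_ffun !card_ord.
Qed.

Section WeightedExponents.

Variables (k : nat) (e : 'I_k -> nat).
Hypothesis e_gt0 : forall i, (0 < e i)%N.

Lemma weighted_gt0 : (0 < #|weighted_exponents e 0|)%N.
Proof.
apply/card_gt0P; exists bm0; rewrite inE big1 // => i _.
by rewrite /= mnm0E muln0.
Qed.

Lemma card_weighted_leq M : (#|weighted_exponents e M| <= M.+1 ^ k)%N.
Proof. exact: leq_trans (max_card _) (card_monomials_leq k M). Qed.

Lemma card_residues :
  #|{: {dffun forall i : 'I_k, 'I_(e i)}}| = (\prod_i e i)%N.
Proof.
rewrite card_dep_ffun foldrE big_map big_enum.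
by apply: eq_bigr => i _; rewrite card_ord.
Qed.

(** Euclidean division of the [i]-th exponent by [e i]. *)
Lemma card_monomials_leq_weighted M :
  (#|{: 'X_{1..k < M.+1}}| <= (\prod_i e i) * #|weighted_exponents e M|)%N.
Proof.
pose q (c : 'X_{1..k}) : 'X_{1..k} := [multinom (c i %/ e i)%N | i < k].
have q_deg c : (mdeg (q c) <= mdeg c)%N.
  by rewrite !mdegE leq_sum // => i _; rewrite mnmE leq_div.
pose qb (c : 'X_{1..k < M.+1}) : 'X_{1..k < M.+1} :=
  BMultinom (leq_ltn_trans (q_deg c) (bmdeg c)).
pose rb (c : 'X_{1..k < M.+1}) : {dffun forall i : 'I_k, 'I_(e i)} :=
  [ffun i => Ordinal (ltn_pmod (c i) (e_gt0 i))].
pose f c := (rb c, qb c).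
have f_inj : injective f.
  move=> c1 c2 eqf; have /ffunP eqr := congr1 fst eqf.
  have {eqf} /(congr1 val) /= eqq := congr1 snd eqf; apply/val_inj/mnmP => i.
  have := congr1 (fun m : 'X_{1..k} => m i) eqq; rewrite !mnmE => {}eqq.
  have := congr1 val (eqr i); rewrite !ffunE /= => eqm.
  by rewrite (divn_eq (c1 i) (e i)) eqm eqq -divn_eq.
rewrite -card_residues -cardsT -[X in (_ <= X * _)%N]cardsT -cardsX.
rewrite -(card_imset setT f_inj); apply/subset_leq_card/subsetP => _ /imsetP[c _ ->].
rewrite inE in_setT inE /=.
rewrite -ltnS (leq_ltn_trans _ (bmdeg c)) // mdegE leq_sum // => i _.
by rewrite mnmE mulnC leq_divM.
Qed.

Lemma weighted_leq_card_monomials M :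
  ((\prod_i e i) * #|weighted_exponents e M| <= #|{: 'X_{1..k < (M + \sum_i e i).+1}}|)%N.
Proof.
pose c (rb : {dffun forall i : 'I_k, 'I_(e i)} * 'X_{1..k < M.+1}) : 'X_{1..k} :=
  [multinom (e i * (rb.2 : 'X_{1..k}) i + rb.1 i)%N | i < k].
have c_deg rb : rb.2 \in weighted_exponents e M -> (mdeg (c rb) < (M + \sum_i e i).+1)%N.
  rewrite inE => wb; rewrite mdegE ltnS.
  rewrite (eq_bigr (fun i => e i * (rb.2 : 'X_{1..k}) i + rb.1 i)%N); last first.
    by move=> i _; rewrite mnmE.
  by rewrite big_split leq_add //= leq_sum // => i _; rewrite ltnW.
pose f rb : 'X_{1..k < (M + \sum_i e i).+1} := insubd bm0 (c rb).
rewrite -card_residues -[X in (X * _ <= _)%N]cardsT -cardsX.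
rewrite -(@card_in_imset _ _ f) ?max_card //.
move=> [r1 b1] [r2 b2]; rewrite !inE /= => wb1 wb2 /(congr1 val).
rewrite !val_insubd !c_deg ?inE // => eqc.
have eqi i : (r1 i = r2 i :> nat) /\ (b1 i = b2 i).
  have := congr1 (fun m : 'X_{1..k} => m i) eqc; rewrite !mnmE /=.
  rewrite [in X in X -> _]mulnC [in X in _ = X -> _]mulnC => eqi.
  split; [move: (congr1 (modn^~ (e i)) eqi) | move: (congr1 (divn^~ (e i)) eqi)].
    by rewrite !modnMDl !modn_small.
  by rewrite !divnMDl ?e_gt0 // !divn_small // !addn0.
congr pair; first by apply/ffunP => i; apply/val_inj; case: (eqi i).
by apply/val_inj/mnmP => i; case: (eqi i).
Qed.

End WeightedExponents.

(** * Linear algebra of bounded-degree polynomials *)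

Lemma linear_dependence (K : fieldType) (T U : finType) (A : T -> U -> K) :
    (#|U| < #|T|)%N ->
  exists2 c : T -> K, (exists t, c t != 0) & forall u, \sum_t c t * A t u = 0.
Proof.
move=> ltUT; pose B := \matrix_(i < #|T|, j < #|U|) A (enum_val i) (enum_val j).
have : kermx B != 0.
  rewrite -mxrank_eq0 mxrank_ker -lt0n subn_gt0.
  exact: leq_ltn_trans (rank_leq_col B) ltUT.
case/rowV0Pn => c /sub_kermxP cB0 /rV0Pn [i ci].
exists (fun t => c 0 (enum_rank t)); first by exists (enum_val i); rewrite enum_valK.
move=> u; have := congr1 (fun D : 'rV_(#|U|) => D 0 (enum_rank u)) cB0.
rewrite !mxE => cB0u; rewrite -[RHS]cB0u [RHS](reindex (@enum_rank T)) /=; last first.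
  by apply: onW_bij; exact: enum_rank_bij.
by apply: eq_bigr => t _; rewrite mxE !enum_rankK.
Qed.

Lemma mpoly_alg_ind (R : comNzRingType) (k : nat) (P : {mpoly R[k]} -> Prop) :
    (forall c, P c%:MP) -> (forall i, P 'X_i) ->
    (forall p q, P p -> P q -> P (p + q)) ->
    (forall p q, P p -> P q -> P (p * q)) ->
  forall p, P p.
Proof.
move=> PC PX PD PM; elim/mpolyind => [|c m q _ _ Pq]; first by rewrite -mpolyC0.
apply: (PD) => //; rewrite -mul_mpolyC; apply: (PM) => //.
rewrite mpolyXE_id; apply: big_ind => [|p1 p2|i _]; [by rewrite -mpolyC1 | exact: PM |].
by elim: (m i) => [|n IH]; rewrite ?expr0 -?mpolyC1 // exprS; exact: PM.
Qed.

Section BoundedDegree.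

Variables (K : fieldType) (k : nat).
Implicit Types (p q : {mpoly K[k]}).

Lemma polynomials_dependent (T : finType) (p : T -> {mpoly K[k]}) (M : nat) :
    (forall t, msize (p t) <= M)%N -> (#|{: 'X_{1..k < M}}| < #|T|)%N ->
  exists2 c : T -> K, (exists t, c t != 0) & \sum_t c t *: p t = 0.
Proof.
move=> pM ltMT.
have [c c0 cp] := linear_dependence (fun t (m : 'X_{1..k < M}) => (p t)@_m) ltMT.
exists c => //; under eq_bigr => t _ do rewrite (mpolywE (pM t)) scaler_sumr.
rewrite exchange_big big1 //= => m _.
under eq_bigr => t _ do rewrite scalerA.
by rewrite -scaler_suml cp scale0r.
Qed.

Lemma card_spanning_polynomials (T : finType) (p : T -> {mpoly K[k]}) (M : nat) :
    (forall q, (msize q <= M)%N -> exists c : T -> K, q = \sum_t c t *: p t) ->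
  (#|{: 'X_{1..k < M}}| <= #|T|)%N.
Proof.
move=> span_p; rewrite leqNgt; apply/negP => ltTM.
have /fin_all_exists [A spanA] (m : 'X_{1..k < M}) :
    exists c : T -> K, 'X_[m] = \sum_t c t *: p t.
  by apply: span_p; rewrite msizeX bmdeg.
have [c [m cm] cA] := linear_dependence A ltTM.
have : \sum_m c m *: 'X_[m : 'X_{1..k < M}] = 0 :> {mpoly K[k]}.
  under eq_bigr => m' _ do rewrite spanA scaler_sumr.
  rewrite exchange_big big1 //= => t _.
  under eq_bigr => m' _ do rewrite scalerA.
  by rewrite -scaler_suml cA scale0r.
move/(congr1 (mcoeff m)); rewrite mcoeff0 raddf_sum (bigD1 m) //=.
rewrite big1 ?addr0 => [|m' /negPf nm']; rewrite mcoeffZ mcoeffX; last first.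
  by rewrite -bmeqP nm' mulr0.
by rewrite eqxx mulr1 => /eqP; exact/negP.
Qed.

Lemma msize_mul_leq p q a b :
  (msize p <= a.+1 -> msize q <= b.+1 -> msize (p * q) <= (a + b).+1)%N.
Proof.
have [->|p0] := eqVneq p 0; first by rewrite mul0r msize0.
have [->|q0] := eqVneq q 0; first by rewrite mulr0 msize0.
by rewrite msizeM //; move: (msize p) (msize q) => x y; lia.
Qed.

Lemma msize_exp_leq p a n : (msize p <= a.+1 -> msize (p ^+ n) <= (a * n).+1)%N.
Proof.
move=> pa; elim: n => [|n IH]; first by rewrite expr0 msize1.
by rewrite exprS mulnS msize_mul_leq.
Qed.

Lemma msize_prod_leq (I : finType) (P : pred I) (p : I -> {mpoly K[k]}) (a : I -> nat) :
    (forall i, P i -> msize (p i) <= (a i).+1)%N ->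
  (msize (\prod_(i | P i) p i) <= (\sum_(i | P i) a i).+1)%N.
Proof.
move=> pa; elim/big_rec2: _ => [|i b q Pi]; first by rewrite msize1.
by apply: msize_mul_leq; exact: pa.
Qed.

Lemma msize_dhomog p d : p \is d.-homog -> (msize p <= d.+1)%N.
Proof.
move/dhomogP => pd; rewrite msizeE; apply/bigmax_leqP_seq => m mp _.
by rewrite pd.
Qed.

Lemma pihomog_eq0 p t : (msize p <= t)%N -> pihomog mdeg t p = 0.
Proof.
move=> pt; rewrite (pihomogwE _ _ (leqnn _)) big1 // => m /eqP mt.
by move: (bmdeg m); rewrite mt ltnNge pt.
Qed.

Lemma pihomog_mul e p q t : p \is e.-homog ->
  pihomog mdeg t (p * q) = if (e <= t)%N then p * pihomog mdeg (t - e) q else 0.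
Proof.
move=> pa; rewrite {1}(pihomog_partitionE (leqnn (msize q))) mulr_sumr raddf_sum /=.
have pq d : p * pihomog mdeg d q \is (e + d).-homog.
  by apply: dhomogM => //; exact: pihomogP.
have piE d : pihomog mdeg t (p * pihomog mdeg d q) =
    if (e + d == t)%N then p * pihomog mdeg d q else 0.
  by case: eqP => [<-|/eqP ne]; [exact: pihomog_dE | exact: pihomog_ne0 (pq d)].
under eq_bigr => d _ do rewrite piE.
case: ifPn => et; last by rewrite big1 // => d _; rewrite ifN //; lia.
have [ltq|geq] := ltnP (t - e) (msize q).
  rewrite (bigD1 (Ordinal ltq)) //= subnKC // eqxx big1 ?addr0 // => d.
  rewrite -val_eqE /= => nd; rewrite ifN //; lia.
rewrite pihomog_eq0 // mulr0 big1 // => d _; rewrite ifN //; move: (ltn_ord d); lia.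
Qed.

End BoundedDegree.

(** * Ideals and regular sequences *)

Section GeneratedIdeal.

Variables (R : comNzRingType) (m : nat) (f : 'I_m -> R).
Implicit Types (P Q : pred 'I_m) (g h : R).

Lemma in_ideal0 P : in_ideal P f 0.
Proof. by exists (fun=> 0); rewrite big1 // => i _; rewrite mul0r. Qed.

Lemma in_idealD P g h : in_ideal P f g -> in_ideal P f h -> in_ideal P f (g + h).
Proof.
case=> a -> [b ->]; exists (fun i => a i + b i); rewrite -big_split.
by apply: eq_bigr => i _; rewrite mulrDl.
Qed.

Lemma in_idealMl P a g : in_ideal P f g -> in_ideal P f (a * g).
Proof.
case=> b ->; exists (fun i => a * b i); rewrite mulr_sumr.
by apply: eq_bigr => i _; rewrite mulrA.
Qed.

Lemma in_idealN P g : in_ideal P f g -> in_ideal P f (- g).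
Proof. by rewrite -mulN1r; exact: in_idealMl. Qed.

Lemma in_ideal_gen P i : P i -> in_ideal P f (f i).
Proof.
move=> Pi; exists (fun j => (j == i)%:R).
rewrite (bigD1 i) //= eqxx mul1r big1 ?addr0 // => j /andP[_ /negPf ->].
by rewrite mul0r.
Qed.

Lemma in_ideal_sum P (T : finType) (A : pred T) (g : T -> R) :
  (forall t, A t -> in_ideal P f (g t)) -> in_ideal P f (\sum_(t | A t) g t).
Proof.
move=> fg; elim/big_rec: _ => [|t h At]; first exact: in_ideal0.
by apply: in_idealD; exact: fg.
Qed.

Lemma in_ideal_sub P Q g : subpred P Q -> in_ideal P f g -> in_ideal Q f g.
Proof.
move=> subPQ [h ->]; apply: in_ideal_sum => i Pi; apply: in_idealMl.
exact/in_ideal_gen/subPQ.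
Qed.

Hypothesis f_reg : regular_seq f.

Lemma regular_seq_exp (i : 'I_m) n g :
  in_ideal (fun j => j < i)%N f (f i ^+ n * g) -> in_ideal (fun j => j < i)%N f g.
Proof.
elim: n g => [|n IH] g; first by rewrite mul1r.
by rewrite exprS -mulrA => /(proj1 f_reg)/IH.
Qed.

(** A polynomial relation on a regular sequence has a coefficient in the ideal:
    the one of the lexicographically smallest exponent. Modulo [f_0 .. f_(i-1)]
    the smallest power of [f_i] can be divided out, and reducing modulo [f_i]
    leaves the exponents where that power is attained. *)
Lemma regular_seq_relation (T : finType) (ex : T -> 'I_m -> nat)
    (Q : {set T}) (p : T -> R) :
    (forall s t, ex s =1 ex t -> s = t) -> Q != set0 ->
    \sum_(t in Q) p t * \prod_i f i ^+ ex t i = 0 ->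
  exists2 t, t \in Q & in_ideal predT f (p t).
Proof.
move=> ex_inj Q0 rel.
have stage n : (n <= m)%N -> exists S : {set T},
    [/\ S \subset Q, S != set0,
        forall s t, s \in S -> t \in S -> forall l : 'I_m, (l < n)%N -> ex s l = ex t l
      & in_ideal (fun j : 'I_m => j < n)%N f
          (\sum_(t in S) p t * \prod_(l < m | (n <= l)%N) f l ^+ ex t l)].
  elim: n => [|n IH] lenm.
    by exists Q; split=> //; rewrite rel; exact: in_ideal0.
  have [S [SQ /set0Pn[s0 Ss0] agree idS]] := IH (ltnW lenm).
  pose i := Ordinal lenm.
  have [t0 St0 t0_min] := @arg_minnP _ s0 (mem S) (fun t => ex t i) Ss0.
  exists [set t in S | ex t i == ex t0 i]; split.
  - by apply/subsetP => t; rewrite inE => /andP[/(subsetP SQ)].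
  - by apply/set0Pn; exists t0; rewrite inE [t0 \in S]St0 eqxx.
  - move=> s t; rewrite !inE => /andP[Ss /eqP si] /andP[St /eqP ti] l.
    rewrite ltnS leq_eqVlt => /predU1P[ln|]; last exact: agree.
    by rewrite (_ : l = i) ?si ?ti //; exact/val_inj.
  pose tail t := p t * \prod_(l < m | (n < l)%N) f l ^+ ex t l.
  have idS' : in_ideal (fun j : 'I_m => j < i)%N f
      (\sum_(t in S) f i ^+ (ex t i - ex t0 i) * tail t).
    apply: (@regular_seq_exp i (ex t0 i)); rewrite mulr_sumr.
    rewrite (_ : \sum_(t in S) _ =
        \sum_(t in S) p t * \prod_(l < m | (n <= l)%N) f l ^+ ex t l) //.
    apply: eq_bigr => t St; rewrite mulrA -exprD subnKC; last exact: t0_min.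
    rewrite [in RHS](bigD1 i) //= mulrCA; congr (_ * (_ * _)).
    by apply: eq_bigl => l; rewrite ltn_neqAle -val_eqE /= eq_sym andbC.
  have -> : \sum_(t in [set t in S | ex t i == ex t0 i]) tail t =
      \sum_(t in S) f i ^+ (ex t i - ex t0 i) * tail t -
      \sum_(t in S | ex t i != ex t0 i) f i ^+ (ex t i - ex t0 i) * tail t.
    rewrite [X in X - _](bigID (fun t => ex t i == ex t0 i)) /= addrK.
    apply: eq_big => [t|t]; first by rewrite inE.
    by rewrite inE => /andP[_ /eqP ->]; rewrite subnn mul1r.
  apply: in_idealD; first by apply: in_ideal_sub idS' => j /= /leqW.
  apply: in_idealN; apply: in_ideal_sum => t /andP[St ne].
  have lt_t : (0 < ex t i - ex t0 i)%N.
    by rewrite subn_gt0 ltn_neqAle eq_sym ne; exact: t0_min.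
  rewrite -(prednK lt_t) exprSr -mulrA [f i * _]mulrC mulrA.
  by apply/in_idealMl/in_ideal_gen; rewrite /= ltnS.
have [S [SQ /set0Pn[t St] agree idS]] := stage m (leqnn m).
exists t; first exact: (subsetP SQ).
rewrite (_ : p t = \sum_(t in S) p t * \prod_(l < m | (m <= l)%N) f l ^+ ex t l).
  exact: in_ideal_sub idS.
rewrite (bigD1 t) //= big_pred0 => [|l]; last by rewrite leqNgt ltn_ord.
rewrite mulr1 big1 ?addr0 // => s /andP[Ss /eqP []].
by apply: ex_inj => l; exact: agree.
Qed.

End GeneratedIdeal.

(** * Zeros of ideals *)

Record is_ideal (R : comNzRingType) (J : R -> Prop) : Prop := IsIdeal {
  ideal0 : J 0;
  idealD : forall x y, J x -> J y -> J (x + y);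
  idealMl : forall a x, J x -> J (a * x) }.

Definition adjoin (R : comNzRingType) (J : R -> Prop) (h x : R) : Prop :=
  exists u w, J u /\ x = u + w * h.

Section Ideals.

Variables (R : comNzRingType) (J : R -> Prop).
Hypothesis idJ : is_ideal J.

Lemma idealN x : J x -> J (- x).
Proof. by rewrite -mulN1r; exact: idealMl. Qed.

Lemma ideal_sum (T : finType) (g : T -> R) : (forall t, J (g t)) -> J (\sum_t g t).
Proof.
by move=> Jg; elim/big_rec: _ => [|t h _]; [exact: ideal0 | exact: idealD].
Qed.

Lemma is_ideal_adjoin h : is_ideal (adjoin J h).
Proof.
split.
- by exists 0, 0; rewrite mul0r addr0; split=> //; exact: ideal0.
- move=> x y [u [w [Ju ->]]] [u' [w' [Ju' ->]]]; exists (u + u'), (w + w').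
  by split; [exact: idealD | rewrite mulrDl addrACA].
- move=> a x [u [w [Ju ->]]]; exists (a * u), (a * w).
  by split; [exact: idealMl | rewrite mulrDr mulrA].
Qed.

Lemma sub_adjoin h x : J x -> adjoin J h x.
Proof. by move=> Jx; exists x, 0; rewrite mul0r addr0. Qed.

Lemma mem_adjoin h : adjoin J h h.
Proof. by exists 0, 1; rewrite mul1r add0r; split=> //; exact: ideal0. Qed.

End Ideals.

Lemma is_ideal_in_ideal (R : comNzRingType) m (f : 'I_m -> R) P :
  is_ideal (in_ideal P f).
Proof.
by split; [exact: in_ideal0 | exact: in_idealD | exact: in_idealMl].
Qed.

Lemma coef_sum_ord (R : nzRingType) s (c : 'I_s -> R) (a : 'I_s) :
  (\sum_b c b *: 'X^b)`_a = c a.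
Proof.
rewrite coef_sum (bigD1 a) //= coefZ coefXn eqxx mulr1 big1 ?addr0 // => b nb.
by rewrite coefZ coefXn eq_sym val_eqE (negPf nb) mulr0.
Qed.

Section Zeros.

Variables (K : closedFieldType) (k : nat).
Implicit Type J : {mpoly K[k]} -> Prop.

(** The factors [q - z] of [P(q)] cannot all be invertible modulo a proper ideal
    containing [P(q)]. *)
Lemma adjoin_root_proper J (P : {poly K}) (q : {mpoly K[k]}) :
    is_ideal J -> ~ J 1 -> P != 0 -> J (map_poly (@mpolyC k K) P).[q] ->
  exists z, ~ adjoin J (q - z%:MP) 1.
Proof.
move=> idJ J1 P0 JP; apply: NNPP => noz; apply: J1.
have unitz z : adjoin J (q - z%:MP) 1.
  by apply: NNPP => nz; apply: noz; exists z.
have [r rP] := closed_field_poly_normal P.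
have : J (\prod_(z <- r) (q - z%:MP)).
  have := idealMl idJ (lead_coef P)^-1%:MP JP; rewrite {2}rP.
  rewrite linearZ rmorph_prod hornerZ horner_prod mulrA -mpolyCM.
  rewrite mulVf ?lead_coef_eq0 // mul1r.
  congr J; apply: eq_bigr => z _.
  by rewrite rmorphB /= map_polyX map_polyC hornerXsubC.
elim: {rP} r => [|z r IH]; first by rewrite big_nil.
rewrite big_cons => Jr; apply: IH.
have [u [w [Ju one]]] := unitz z.
rewrite -[X in J X]mul1r {1}one mulrDl; apply: (idealD idJ).
  by rewrite mulrC; exact: idealMl.
by rewrite -mulrA; exact: idealMl.
Qed.

(** One variable at a time, a proper ideal modulo which all the variables are
    algebraic is enlarged until it contains all [X_i - x_i]; it is then the ideal
    of the polynomials vanishing at [x]. *)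
Lemma proper_ideal_zero J :
    is_ideal J -> ~ J 1 ->
    (forall i, exists2 P : {poly K}, P != 0 & J (map_poly (@mpolyC k K) P).['X_i]) ->
  exists x : 'I_k -> K, forall p, J p -> p.@[x] = 0.
Proof.
move=> idJ J1 algJ.
have enlarge (s : seq 'I_k) : exists J' : {mpoly K[k]} -> Prop,
    [/\ is_ideal J', ~ J' 1, forall p, J p -> J' p
      & forall i, i \in s -> exists z, J' ('X_i - z%:MP)].
  elim: s => [|i s [J' [idJ' J'1 JJ' sJ']]]; first by exists J.
  have [P P0 JP] := algJ i.
  have [z nz] := adjoin_root_proper idJ' J'1 P0 (JJ' _ JP).
  exists (adjoin J' ('X_i - z%:MP)); split=> //; first exact: is_ideal_adjoin.
    by move=> p /JJ' J'p; exact: sub_adjoin.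
  move=> j; rewrite inE => /predU1P[->|/sJ' [z' J'z']].
    by exists z; exact: mem_adjoin.
  by exists z'; exact: sub_adjoin.
have [J' [idJ' J'1 JJ' J'X]] := enlarge (enum 'I_k).
have /fin_all_exists [x J'x] i : exists z, J' ('X_i - z%:MP).
  by apply: J'X; rewrite mem_enum.
exists x => p Jp.
have J'ev : J' (p - p.@[x]%:MP).
  elim/mpoly_alg_ind: p {Jp} => [c|i|p q Jp Jq|p q Jp Jq].
  - by rewrite mevalC subrr; exact: ideal0.
  - by rewrite mevalXU.
  - by rewrite mevalD mpolyCD opprD addrACA; exact: idealD.
  - rewrite mevalM mpolyCM.
    have -> : p * q - p.@[x]%:MP * q.@[x]%:MP =
        q * (p - p.@[x]%:MP) + p.@[x]%:MP * (q - q.@[x]%:MP).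
      by ring.
    by apply: (idealD idJ'); exact: idealMl.
apply/eqP/negPn/negP => px0; apply: J'1.
have J'px : J' p.@[x]%:MP.
  rewrite -[X in J' X](subKr p); apply: (idealD idJ'); first exact: JJ'.
  exact: idealN.
have := idealMl idJ' (p.@[x])^-1%:MP J'px.
by rewrite -mpolyCM mulVf.
Qed.

End Zeros.

Section RegularSequenceZeros.

Variables (K : closedFieldType) (m : nat) (f : 'I_m -> {mpoly K[m.+1]}).
Hypothesis f_reg : regular_seq f.

(** The [m + 2] polynomials [u], [g], [f_i] in [m + 1] variables are algebraically
    dependent, as a count of the products with all exponents below [s] shows. *)
Lemma algebraic_modulo_regular_seq (u g : {mpoly K[m.+1]}) :
  exists s (c : 'I_s * 'I_s -> K), (exists ab, c ab != 0) /\
    in_ideal predT f (\sum_ab c ab *: (u ^+ ab.1 * g ^+ ab.2)).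
Proof.
pose E := (msize u + msize g + \sum_i msize (f i))%N.
(* The products have degree at most s C, and (s C + 1) ^ (m + 1) < s ^ (m + 2). *)
pose C := ((m + 2) * E)%N; pose s := (C.+1 ^ m.+1).+1.
pose T : finType := (('I_s * 'I_s) * {ffun 'I_m -> 'I_s})%type.
pose q (t : T) := (u ^+ t.1.1 * g ^+ t.1.2) * \prod_i f i ^+ t.2 i.
have q_size t : (msize (q t) <= (s * C).+1)%N.
  have sizeE (p : {mpoly K[m.+1]}) (n : 'I_s) : (msize p <= E)%N ->
      (msize (p ^+ n) <= (s * E).+1)%N.
    move=> pE; apply: (@leq_trans (E * n).+1); first exact/msize_exp_leq/leqW.
    by rewrite ltnS mulnC leq_mul2r ltnW ?orbT.
  have -> : (s * C = s * E + s * E + \sum_(i < m) s * E)%N.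
    by rewrite big_const iter_addn_0 card_ord /C; lia.
  apply: msize_mul_leq; first apply: msize_mul_leq.
  - by apply: sizeE; rewrite /E -addnA leq_addr.
  - by apply: sizeE; rewrite /E addnAC leq_addl.
  - apply: msize_prod_leq => i _; apply: sizeE.
    by rewrite /E (bigD1 i) //= addnCA leq_addr.
have card_lt : (#|{: 'X_{1..m.+1 < (s * C).+1}}| < #|T|)%N.
  apply: leq_ltn_trans (card_monomials_leq _ _) _.
  rewrite !card_prod card_ffun !card_ord -mulnA -!expnS.
  apply: (@leq_ltn_trans ((s * C.+1) ^ m.+1)%N).
    by rewrite leq_exp2r // mulnS {3}/s addSn ltnS leq_addl.
  by rewrite expnMn [ltnRHS]expnS mulnC ltn_pmul2r // expn_gt0.
have [c [[ab0 e0] c0] rel] := polynomials_dependent q_size card_lt.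
pose Q := [set e : {ffun 'I_m -> 'I_s} | [exists ab, c (ab, e) != 0]].
pose p (e : {ffun 'I_m -> 'I_s}) := \sum_ab c (ab, e) *: (u ^+ ab.1 * g ^+ ab.2).
have [|||e] := @regular_seq_relation _ _ f f_reg _
    (fun (e : {ffun 'I_m -> 'I_s}) i => e i : nat) Q p.
- by move=> e e' ee'; apply/ffunP => i; exact/val_inj/ee'.
- by apply/set0Pn; exists e0; rewrite inE; apply/existsP; exists ab0.
- rewrite -[RHS]rel (eq_bigr (fun t => c (t.1, t.2) *: q (t.1, t.2))); last by case.
  rewrite -(pair_bigA _ (fun ab e => c (ab, e) *: q (ab, e))) exchange_big /=.
  rewrite [RHS](bigID (mem Q)) /= [X in _ = _ + X]big1 ?addr0 => [|e].
    apply: eq_bigr => e _; rewrite mulr_suml.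
    by apply: eq_bigr => ab _; rewrite -scalerAl.
  rewrite inE negb_exists => /forallP ce0; apply: big1 => ab _.
  by move: (ce0 ab); rewrite negbK => /eqP ->; rewrite scale0r.
rewrite inE => /existsP[ab cab] idp.
by exists s, (fun ab => c (ab, e)); split; first exists ab.
Qed.

Variable d : 'I_m -> nat.
Hypothesis f_hom : forall i, f i \is (d i).-homog.

Lemma in_ideal_pihomog g t :
  in_ideal predT f g -> in_ideal predT f (pihomog mdeg t g).
Proof.
case=> h ->; rewrite raddf_sum /=; apply: in_ideal_sum => i _.
rewrite mulrC (pihomog_mul _ _ (f_hom i)); case: ifP => _; last exact: in_ideal0.
by rewrite mulrC; exact/in_idealMl/in_ideal_gen.
Qed.

(** For all but finitely many [c], the variables are algebraic modulo
    [I + (g - c)]; a zero of this ideal would be a zero of [I] where [g] takes the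
    value [c], so that ideal is the unit ideal. As [I] is graded, inverting [g - c]
    by a geometric series forces a power of [g] to be in [I]. *)
Lemma homogeneous_nullstellensatz g e :
    g \is e.-homog -> (0 < e)%N ->
    (forall x, (forall i, (f i).@[x] = 0) -> g.@[x] = 0) ->
  exists n, in_ideal predT f (g ^+ n).
Proof.
move=> g_hom e_gt0 g_zero.
have dep i := algebraic_modulo_regular_seq 'X_i g.
have [s /fin_all_exists [c c_dep]] := fin_all_exists dep.
have /fin_all_exists [ab c_ab] i : exists ab, c i ab != 0 by case: (c_dep i).
pose row i (a : 'I_(s i)) := \sum_b c i (a, b) *: 'X^b : {poly K}.
have row_neq0 i : row i (ab i).1 != 0.
  apply/eqP => /(congr1 (fun P : {poly K} => P`_((ab i).2))) /eqP.
  by rewrite coef0 coef_sum_ord -surjective_pairing; exact/negP.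
have /closed_nonrootP [z] : 'X * \prod_i row i (ab i).1 != 0.
  by rewrite mulf_neq0 ?polyX_eq0 //; apply/prodf_neq0.
rewrite rootM rootX negb_or => /andP[z0 rowz].
pose P i := \sum_a (row i a).[z] *: 'X^a : {poly K}.
have P_neq0 i : P i != 0.
  apply: contraNneq rowz => /(congr1 (fun P : {poly K} => P`_((ab i).1))).
  by rewrite coef0 coef_sum_ord /root horner_prod => Pi0; apply/prodf_eq0; exists i; rewrite ?Pi0.
pose J := adjoin (in_ideal predT f) (g - z%:MP).
have idI := is_ideal_in_ideal f predT.
have idJ : is_ideal J by exact: is_ideal_adjoin.
have algJ i : J (map_poly (@mpolyC m.+1 K) (P i)).['X_i].
  have [_ /(sub_adjoin (g - z%:MP)) Jrel] := c_dep i.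
  rewrite -[X in J X](subrK (\sum_ab c i ab *: ('X_i ^+ ab.1 * g ^+ ab.2))).
  apply: (idealD idJ) => //.
  have -> : (map_poly (@mpolyC m.+1 K) (P i)).['X_i] =
      \sum_ab c i ab *: ('X_i ^+ ab.1 * (z ^+ ab.2)%:MP).
    rewrite (eq_bigr (fun ab => c i (ab.1, ab.2) *: ('X_i ^+ ab.1 * (z ^+ ab.2)%:MP)));
      last by case.
    rewrite -(pair_bigA _ (fun a b => c i (a, b) *: ('X_i ^+ a * (z ^+ b)%:MP))) /=.
    rewrite rmorph_sum horner_sum; apply: eq_bigr => a _.
    rewrite /= map_polyZ /= hornerZ map_polyXn hornerXn horner_sum rmorph_sum mulr_suml.
    apply: eq_bigr => b _.
    by rewrite hornerZ hornerXn /= mpolyCM -mul_mpolyC; ring.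
  rewrite -sumrB; apply: ideal_sum => // ab'.
  rewrite -scalerBr -mulrBr -mul_mpolyC mulrA (rmorphXn (@mpolyC m.+1 K)); apply: (idealMl idJ).
  rewrite subrXX mulrC -(opprB g) mulrN; apply/(idealN idJ)/(idealMl idJ).
  exact: mem_adjoin.
have : J 1.
  apply: NNPP => J1.
  have [|x x_zero] := proper_ideal_zero idJ J1; first by move=> i; exists (P i).
  have gz : g.@[x] = z.
    have := x_zero _ (mem_adjoin idI (g - z%:MP)).
    by rewrite mevalB mevalC => /eqP; rewrite subr_eq0 => /eqP.
  case/negP: z0; rewrite -gz; apply/eqP/g_zero => i.
  by apply/x_zero/sub_adjoin/in_ideal_gen.
case=> u [w [Iu one]]; pose w_ t := pihomog mdeg (t * e) w.
have piZ t : pihomog mdeg t (z%:MP * w) = z%:MP * pihomog mdeg t w.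
  by rewrite !mul_mpolyC linearZ.
(* Modulo the ideal, w is the inverse of g - z and its part of degree t e is
   - g ^ t / z ^ (t + 1). *)
have series t : in_ideal predT f (g ^+ t + (z ^+ t.+1)%:MP * w_ t).
  elim: t => [|t IH].
    have := in_ideal_pihomog 0 Iu.
    have -> : u = 1 - w * (g - z%:MP) by rewrite one addrK.
    rewrite mulrBr [w * g]mulrC [w * _]mulrC !pihomogB piZ.
    rewrite (pihomog_mul _ _ g_hom) leqNgt e_gt0 /=.
    rewrite (pihomog_dE (dhomog1 _ _)) sub0r opprK.
    by rewrite /w_ mul0n expr1.
  have := in_idealD (in_idealMl g IH) (in_idealMl (z ^+ t.+1)%:MP (in_ideal_pihomog (t.+1 * e) Iu)).
  have -> : u = 1 - w * (g - z%:MP) by rewrite one addrK.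
  rewrite mulrBr [w * g]mulrC [w * _]mulrC !pihomogB piZ.
  rewrite (pihomog_mul _ _ g_hom) mulSn leq_addr addKn.
  rewrite (@pihomog_ne0 _ _ _ 0) ?dhomog1 //; last by rewrite eq_sym -lt0n addn_gt0 e_gt0.
  rewrite -/(w_ t) -mulSn -/(w_ t.+1).
  congr in_ideal; rewrite (exprS z t.+1) mpolyCM (exprS g); ring.
exists (msize w); have := series (msize w).
by rewrite /w_ pihomog_eq0 ?mulr0 ?addr0 // leq_pmulr.
Qed.

End RegularSequenceZeros.

(** * A bound for the number of nonsingular zeros *)

Definition gradient (R : comNzRingType) (k : nat) (x : 'rV[R]_k) (p : {mpoly R[k]}) :
  'rV[R]_k := \row_j evalpt x p^`M(j).

Section Gradient.

Variables (R : comNzRingType) (k : nat) (x : 'rV[R]_k).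

Lemma evalptM (p q : {mpoly R[k]}) : evalpt x (p * q) = evalpt x p * evalpt x q.
Proof. exact: mevalM. Qed.

Lemma gradientM (p q : {mpoly R[k]}) :
  gradient x (p * q) = evalpt x q *: gradient x p + evalpt x p *: gradient x q.
Proof.
apply/rowP => j; rewrite !mxE mderivM /evalpt mevalD !mevalM.
by rewrite [X in X + _]mulrC.
Qed.

Lemma gradient_sum (I : finType) (A : pred I) (p : I -> {mpoly R[k]}) :
  gradient x (\sum_(i | A i) p i) = \sum_(i | A i) gradient x (p i).
Proof.
apply/rowP => j; rewrite summxE mxE /evalpt (raddf_sum (mderiv j)) raddf_sum /=.
by apply: eq_bigr => i _; rewrite mxE.
Qed.

Lemma gradientX i : gradient x 'X_i = delta_mx 0 i.
Proof.
apply/rowP => j; rewrite !mxE eqxx /= mderivX mnm1E eq_sym.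
case: eqP => [->|_]; last by rewrite scale0r /evalpt meval0.
by rewrite -[X in (X - _)%MM]addm0 addmC addmK mpolyX0 scale1r /evalpt meval1.
Qed.

Lemma gradientC c : gradient x c%:MP = 0.
Proof. by apply/rowP => j; rewrite !mxE mderivC /evalpt meval0. Qed.

(** The expansion of [p] at [x], with the degree of the displacement recorded by
    the outer variable: [tau p] is [p (x + t *: X)] as a polynomial in [t]. *)
Lemma expansion_exists :
  exists tau : {rmorphism {mpoly R[k]} -> {poly {mpoly R[k]}}},
    (forall c, tau c%:MP = c%:MP%:P) /\
    (forall p, (tau p)`_0 = (evalpt x p)%:MP /\
       (tau p)`_1 = \sum_j gradient x p 0 j *: 'X_j).
Proof.
pose tau : {rmorphism {mpoly R[k]} -> {poly {mpoly R[k]}}} :=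
  mmap (polyC \o @mpolyC k R) (fun i => (x 0 i)%:MP%:P + 'X_i *: 'X).
have tauC c : tau c%:MP = c%:MP%:P by exact: mmapC.
have tauX i : tau 'X_i = (x 0 i)%:MP%:P + 'X_i *: 'X.
  by rewrite /tau /= mmapX mmap1U.
exists tau; split=> //; move: tau tauC tauX => tau tauC tauX p.
elim/mpoly_alg_ind: p => [c|i|p q [p0 p1] [q0 q1]|p q [p0 p1] [q0 q1]].
- rewrite tauC !coefC /evalpt mevalC; split=> //.
  by rewrite big1 // => j _; rewrite gradientC mxE scale0r.
- rewrite tauX !coefD !coefC !coefZ !coefX /= mulr0 mulr1 addr0 add0r /evalpt mevalXU.
  split=> //; rewrite gradientX (bigD1 i) //= mxE !eqxx scale1r big1 ?addr0 //.
  by move=> j /negPf nj; rewrite mxE nj andbF scale0r.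
- rewrite rmorphD !coefD p0 p1 q0 q1 /evalpt mevalD mpolyCD; split=> //.
  rewrite -big_split; apply: eq_bigr => j _ /=.
  by rewrite -scalerDl !mxE mderivD /evalpt mevalD.
- rewrite rmorphM coef0M p0 q0 -mpolyCM -evalptM; split=> //.
  rewrite coefM !big_ord_recr big_ord0 /= add0r subnn subn0 p0 p1 q0 q1.
  rewrite mulr_sumr mulr_suml -big_split /=; apply: eq_bigr => j _.
  rewrite gradientM !mxE scalerDl -scalerAl [_ * _%:MP]mulrC -!mul_mpolyC.
  by rewrite !mpolyCM; ring.
Qed.

End Gradient.

Section NonsingularZeros.

Variables (K : fieldType) (k : nat) (I : finType) (P : I -> 'rV[K]_k).
Variables (e : 'I_k -> nat) (F : 'I_k -> {mpoly K[k]}).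
Variables (E : nat) (G : I -> {mpoly K[k]}).
Hypothesis e_gt0 : forall l, (0 < e l)%N.
Hypothesis F_size : forall l, (msize (F l) <= (e l).+1)%N.
Hypothesis F_zero : forall i l, evalpt (P i) (F l) = 0.
Hypothesis F_jac : forall i, \matrix_l gradient (P i) (F l) \in unitmx.
Hypothesis G_size : forall i, (msize (G i) <= E.+1)%N.
Hypothesis G_sep : forall i j, (evalpt (P j) (G i) == 0) = (i != j).

(** The products [G_i * F ^ b] are linearly independent. In a relation, look at a
    term [(i, b)] with [b] of minimal degree: the part of lowest order at [P i] is
    a relation between the monomials of degree [|b|] in the linear parts of the
    [F_l], which are coordinates. *)
Lemma card_zeros_leq M :
  (#|I| * #|weighted_exponents e M| <= #|{: 'X_{1..k < (M + E).+1}}|)%N.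
Proof.
pose T : finType := (I * {b : 'X_{1..k < M.+1} | b \in weighted_exponents e M})%type.
pose ex (t : T) : 'X_{1..k} := val t.2.
pose p (t : T) := G t.1 * \prod_l F l ^+ ex t l.
have p_size t : (msize (p t) <= (M + E).+1)%N.
  rewrite addnC; apply: msize_mul_leq => //.
  apply: (@leq_trans (\sum_l e l * ex t l).+1).
    by apply: msize_prod_leq => l _; exact: msize_exp_leq.
  by have := valP t.2; rewrite inE.
have -> : (#|I| * #|weighted_exponents e M| = #|T|)%N by rewrite card_prod card_sig.
rewrite leqNgt; apply/negP => /(polynomials_dependent p_size)[c [t0 ct0] rel].
have [s cs s_min] := @arg_minnP _ t0 (fun t => c t != 0) (fun t => mdeg (ex t)) ct0.
set i := s.1 in cs s_min; pose x := P i.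
pose lin l := \sum_j gradient x (F l) 0 j *: 'X_j : {mpoly K[k]}.
pose a t := c t * (mdeg (ex t) == mdeg (ex s))%:R * evalpt x (G t.1).
have [tau [tauC tauE]] := expansion_exists x.
pose q l := drop_poly 1 (tau (F l)).
have tauF l : tau (F l) = q l * 'X.
  apply/polyP => -[|n]; rewrite coefMX /=; last by rewrite coef_drop_poly addn1.
  by rewrite (proj1 (tauE _)) F_zero mpolyC0.
have q0 l : (q l)`_0 = lin l.
  by rewrite coef_drop_poly (proj2 (tauE _)).
have tauFX (b : 'X_{1..k}) :
    tau (\prod_l F l ^+ b l) = (\prod_l q l ^+ b l) * 'X^(mdeg b).
  rewrite rmorph_prod mdegE -prodrXr -big_split; apply: eq_bigr => l _.
  by rewrite rmorphXn tauF exprMn.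
have lowest : \sum_t a t *: \prod_l lin l ^+ ex t l = 0.
  have := congr1 (fun r => (tau r)`_(mdeg (ex s))) rel.
  rewrite rmorph0 coef0 rmorph_sum coef_sum => rels; rewrite -[RHS]rels.
  apply: eq_bigr => t _; rewrite -!mul_mpolyC !(rmorphM tau) tauC tauFX.
  rewrite coefCM mulrA coefMXn /a.
  case: ltnP => [lt_st|le_ts]; first by rewrite gtn_eqF // !mulr0 !mul0r.
  have [ct|/s_min] := eqVneq (c t) 0; first by rewrite ct !mul0r ?mpolyC0 ?mul0r.
  move=> le_st; have st : mdeg (ex t) = mdeg (ex s) by apply/eqP; rewrite eqn_leq le_ts.
  rewrite st eqxx subnn coef0M (proj1 (tauE _)) mulr1 mpolyCM coef0_prod.
  by rewrite -mulrA; do 2!congr (_ * _); apply: eq_bigr => l _;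
    rewrite -horner_coef0 horner_exp horner_coef0 q0.
pose J := \matrix_l gradient x (F l).
pose coord := [tuple \sum_l invmx J j l *: 'X_l | j < k].
have J_inv l l' : \sum_j gradient x (F l) 0 j * invmx J j l' = (l == l')%:R.
  have := congr1 (fun B : 'M_k => B l l') (mulmxV (F_jac i)).
  rewrite mxE [RHS]mxE => <-; apply: eq_bigr => j _.
  by congr (_ * _); rewrite [RHS]mxE.
have lin_coord l : lin l \mPo coord = 'X_l.
  rewrite /lin rmorph_sum /=.
  under eq_bigr => j _ do rewrite comp_mpolyZ comp_mpolyXU -tnth_nth tnth_mktuple scaler_sumr.
  rewrite exchange_big /=.
  under eq_bigr => l' _ do (under eq_bigr => j _ do rewrite scalerA).
  under eq_bigr => l' _ do rewrite -scaler_suml J_inv.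
  rewrite (bigD1 l) //= eqxx scale1r big1 ?addr0 // => l' nl'.
  by rewrite eq_sym (negPf nl') scale0r.
have : \sum_t a t *: 'X_[ex t] = 0.
  have := congr1 (comp_mpoly coord) lowest.
  rewrite comp_mpoly0 raddf_sum /= => coord0; rewrite -[RHS]coord0; apply: eq_bigr => t _.
  rewrite comp_mpolyZ rmorph_prod mpolyXE_id; congr (_ *: _).
  by apply: eq_bigr => l _; rewrite rmorphXn /= lin_coord.
move/(congr1 (mcoeff (ex s))); rewrite mcoeff0 raddf_sum (bigD1 s) //=.
rewrite mcoeffZ mcoeffX eqxx mulr1 big1 => [|t].
  rewrite addr0 /a eqxx mulr1 => /eqP; rewrite mulf_eq0 (negPf cs) /=.
  by rewrite G_sep eqxx.
move=> nts; rewrite mcoeffZ mcoeffX; have [es|] := eqVneq (ex t) (ex s); last by rewrite mulr0.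
rewrite /a; have /eqP -> : evalpt x (G t.1) == 0.
  rewrite G_sep; apply: contra nts => /eqP ts; rewrite -pair_eqE /pair_eq ts eqxx /=.
  by apply/eqP/val_inj/val_inj.
by rewrite mulr0 mul0r.
Qed.

Lemma card_nonsingular_zeros : (#|I| <= \prod_l e l)%N.
Proof.
apply: (@leq_of_poly_growth (fun M => #|weighted_exponents e M|) _ _ E k); last first.
- by move=> M; exact: card_weighted_leq.
- exact: weighted_gt0.
move=> M; apply: leq_trans (card_zeros_leq M) _.
exact: card_monomials_leq_weighted.
Qed.

End NonsingularZeros.

(** * Complete intersections have enough points *)

Section EnoughPoints.

Variables (K : fieldType) (m n : nat) (d : 'I_m -> nat).
Variables (f : 'I_m -> {mpoly K[m.+1]}) (w : 'I_n -> 'rV[K]_m.+1).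
Hypothesis f_hom : forall i, f i \is (d i).-homog.
Hypothesis d_gt0 : forall i, (0 < d i)%N.
Hypothesis vanishing : forall t (p : {mpoly K[m.+1]}), p \is t.-homog ->
  (forall j, evalpt (w j) p = 0) -> in_ideal predT f p.

Lemma in_ideal_dhomog t p : p \is t.-homog -> in_ideal predT f p ->
  exists2 h : 'I_m -> {mpoly K[m.+1]},
    p = \sum_i f i * h i
  & forall i, h i \is (t - d i).-homog /\ ((t < d i)%N -> h i = 0).
Proof.
move=> p_hom [h hE].
exists (fun i => if (d i <= t)%N then pihomog mdeg (t - d i) (h i) else 0).
  rewrite -(pihomog_dE p_hom) hE raddf_sum; apply: eq_bigr => i _ /=.
  rewrite mulrC (pihomog_mul _ _ (f_hom i)).
  by case: ifP => // _; rewrite mulr0.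
move=> i; split; last by rewrite ltnNge => /negPf ->.
by case: ifP => _; [exact: pihomogP | exact: dhomog0].
Qed.

Definition monomial_values t :=
  \matrix_(a < #|{: 'X_{1..m.+1 < t.+1}}|, j < n)
    evalpt (w j) (pihomog mdeg t 'X_[enum_val a : 'X_{1..m.+1 < t.+1}]).

(** The forms of degree [t] that represent a generating family of the image of
    the evaluation map, obtained from a partial inverse of that map; there are [n]
    of them for all [t], while Lagrange interpolation needs [t] to be large. *)
Definition interpolation_form t (j : 'I_n) : {mpoly K[m.+1]} :=
  \sum_a pinvmx (monomial_values t) j a *:
    pihomog mdeg t 'X_[enum_val a : 'X_{1..m.+1 < t.+1}].

Lemma interpolation_form_hom t j : interpolation_form t j \is t.-homog.
Proof. by apply: rpred_sum => a _; apply: rpredZ; exact: pihomogP. Qed.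

Lemma interpolation_formP t p : p \is t.-homog ->
  exists c : 'I_n -> K,
    in_ideal predT f (p - \sum_j c j *: interpolation_form t j).
Proof.
move=> p_hom; pose V := monomial_values t.
pose u := \row_(a < #|{: 'X_{1..m.+1 < t.+1}}|) p@_(enum_val a).
have pE : p = \sum_a u 0 a *: pihomog mdeg t 'X_[enum_val a].
  rewrite -{1}(pihomog_dE p_hom) {1}(mpolywE (msize_dhomog p_hom)) raddf_sum /=.
  rewrite (reindex (@enum_val _ predT)) /=; last exact/onW_bij/enum_val_bij.
  by apply: eq_bigr => a _; rewrite linearZ mxE.
exists (fun j => (u *m V) 0 j); apply: (@vanishing t).
  rewrite rpredB // rpred_sum // => j _; rewrite rpredZ //.
  exact: interpolation_form_hom.
move=> i; rewrite /evalpt mevalB (raddf_sum (meval _)) /=.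
have -> : p.@[fun l => w i 0 l] = (u *m V) 0 i.
  rewrite {1}pE raddf_sum mxE; apply: eq_bigr => a _ /=.
  by rewrite mevalZ [V _ _]mxE.
have -> : (u *m V) 0 i = \sum_j (u *m V) 0 j * (pinvmx V *m V) j i.
  by rewrite -{1}(mulmxKpV (submxMl u V)) -mulmxA mxE.
apply/eqP; rewrite subr_eq0; apply/eqP.
apply: eq_bigr => j _; rewrite mevalZ; congr (_ * _).
rewrite mxE raddf_sum; apply: eq_bigr => a _ /=.
by rewrite mevalZ [V _ _]mxE.
Qed.

(** The forms [f_i] have the weights [d_i], and the constant [F_0 = 1] has weight
    [1], so that weight [M] also accounts for forms of degree less than [M]. *)
Let e (l : 'I_m.+1) : nat := oapp d 1 (unlift ord0 l).
Let F (l : 'I_m.+1) : {mpoly K[m.+1]} := oapp f 1 (unlift ord0 l).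

Lemma padded_degree_gt0 l : (0 < e l)%N.
Proof. by rewrite /e; case: unlift. Qed.

Lemma prod_padded_degree : (\prod_l e l = \prod_i d i)%N.
Proof.
rewrite big_ord_recl /e unlift_none mul1n.
by apply: eq_bigr => i _; rewrite liftK.
Qed.

Let weight (b : 'X_{1..m.+1}) := (\sum_l e l * b l)%N.

Lemma weightD b b' : weight (b + b')%MM = (weight b + weight b')%N.
Proof.
by rewrite /weight -big_split; apply: eq_bigr => l _; rewrite mnmDE mulnDr.
Qed.

Lemma weightU l : weight U_(l)%MM = e l.
Proof.
rewrite /weight (bigD1 l) //= mnm1E eqxx muln1 big1 ?addn0 // => l' nl'.
by rewrite mnm1E eq_sym (negPf nl') muln0.
Qed.

Section Span.

Variable M : nat.

Let T : finType := ({b : 'X_{1..m.+1 < M.+1} | b \in weighted_exponents e M} * 'I_n)%type.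
Let q (s : T) : {mpoly K[m.+1]} :=
  \prod_l F l ^+ (val s.1 : 'X_{1..m.+1}) l *
    interpolation_form (M - weight (val s.1 : 'X_{1..m.+1})) s.2.
Let spanned (p : {mpoly K[m.+1]}) := exists c : T -> K, p = \sum_s c s *: q s.

Lemma spanned0 : spanned 0.
Proof. by exists (fun=> 0); rewrite big1 // => s _; rewrite scale0r. Qed.

Lemma spannedD p1 p2 : spanned p1 -> spanned p2 -> spanned (p1 + p2).
Proof.
case=> c1 -> [c2 ->]; exists (fun s => c1 s + c2 s).
by rewrite -big_split; apply: eq_bigr => s _; rewrite scalerDl.
Qed.

Lemma spannedZ a p : spanned p -> spanned (a *: p).
Proof.
case=> c ->; exists (fun s => a * c s); rewrite scaler_sumr.
by apply: eq_bigr => s _; rewrite scalerA.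
Qed.

Lemma spanned_sum (J : finType) (p : J -> {mpoly K[m.+1]}) :
  (forall j, spanned (p j)) -> spanned (\sum_j p j).
Proof.
move=> sp; elim/big_rec: _ => [|j r _]; first exact: spanned0.
exact: spannedD.
Qed.

Lemma spanned_gen (b : 'X_{1..m.+1}) t j : (weight b + t = M)%N ->
  spanned (\prod_l F l ^+ b l * interpolation_form t j).
Proof.
move=> bt; have b_le : (weight b <= M)%N by rewrite -bt leq_addr.
have b_deg : (mdeg b < M.+1)%N.
  rewrite ltnS (leq_trans _ b_le) // mdegE leq_sum // => l _.
  by rewrite leq_pmull ?padded_degree_gt0.
have b_in : BMultinom b_deg \in weighted_exponents e M by rewrite inE.
pose s : T := (exist _ (BMultinom b_deg) b_in, j).
exists (fun s' => (s' == s)%:R); rewrite (bigD1 s) //= eqxx scale1r [X in _ + X]big1 ?addr0.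
  by rewrite /q /=; have -> : (M - weight b = t)%N by rewrite -bt addKn.
by move=> s' /negPf ->; rewrite scale0r.
Qed.

(** Up to interpolation forms, [p] is a combination of the [f_i] with coefficients
    of smaller degree. *)
Lemma spanned_form t p (b : 'X_{1..m.+1}) : p \is t.-homog -> (weight b + t = M)%N ->
  spanned (\prod_l F l ^+ b l * p).
Proof.
elim/ltn_ind: t p b => t IH p b p_hom bt.
have [c pI] := interpolation_formP p_hom.
rewrite -(subrK (\sum_j c j *: interpolation_form t j) p) mulrDr.
apply: spannedD; last first.
  rewrite mulr_sumr; apply: spanned_sum => j; rewrite -scalerAr.
  by apply/spannedZ/spanned_gen.
have r_hom : p - \sum_j c j *: interpolation_form t j \is t.-homog.
  rewrite rpredB // rpred_sum // => j _; rewrite rpredZ //.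
  exact: interpolation_form_hom.
have [h -> h_hom] := in_ideal_dhomog r_hom pI.
rewrite mulr_sumr; apply: spanned_sum => i.
have [hi_hom hi0] := h_hom i.
have [/hi0 ->|ge_td] := ltnP t (d i); first by rewrite !mulr0; exact: spanned0.
have -> : \prod_l F l ^+ b l * (f i * h i) =
    \prod_l F l ^+ (b + U_(lift ord0 i))%MM l * h i.
  rewrite mulrA; congr (_ * _).
  under [RHS]eq_bigr => l _ do rewrite mnmDE exprD.
  rewrite big_split; congr (_ * _).
  rewrite (bigD1 (lift ord0 i)) //= mnm1E eqxx expr1 /F liftK.
  rewrite big1 ?mulr1 // => l nl.
  by rewrite mnm1E eq_sym (negPf nl) expr0.
apply: (IH (t - d i)%N) => //; first by rewrite ltn_subrL d_gt0 (leq_trans _ ge_td).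
by rewrite weightD weightU /e liftK -addnA subnKC.
Qed.

Lemma card_monomials_leq_points : (#|{: 'X_{1..m.+1 < M.+1}}| <= n * #|weighted_exponents e M|)%N.
Proof.
have -> : (n * #|weighted_exponents e M| = #|T|)%N by rewrite card_prod card_sig card_ord mulnC.
apply: (@card_spanning_polynomials _ _ _ q) => p p_size.
rewrite (pihomog_partitionE p_size); apply: spanned_sum => t.
pose b : 'X_{1..m.+1} := (U_(ord0) *+ (M - t))%MM.
have -> : pihomog mdeg t p = \prod_l F l ^+ b l * pihomog mdeg t p.
  rewrite big1 ?mul1r // => l _; rewrite mulmnE mnm1E.
  by case: eqP => [<-|_]; rewrite ?mul0n // /F unlift_none expr1n.
apply: spanned_form (pihomogP _ _ _) _.
rewrite /weight big_ord_recl big1 => [|i _]; last first.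
  by rewrite mulmnE mnm1E /= muln0.
by rewrite mulmnE mnm1E eqxx mul1n /e unlift_none mul1n addn0 subnK // -ltnS.
Qed.

End Span.

Lemma complete_intersection_points_geq : (\prod_i d i <= n)%N.
Proof.
rewrite -prod_padded_degree.
apply: (@leq_of_poly_growth (fun M => #|weighted_exponents e M|) _ _ (\sum_l e l) m.+1); last first.
- by move=> M; apply: card_weighted_leq; exact: padded_degree_gt0.
- exact: weighted_gt0.
move=> M; apply: leq_trans (weighted_leq_card_monomials padded_degree_gt0 M) _.
exact: card_monomials_leq_points.
Qed.

End EnoughPoints.

(** * Generic combinations *)

(** The coefficients are the powers of a single scalar that avoids the roots of
    finitely many nonzero polynomials. *)
Lemma generic_combination (K : closedFieldType) (Z : finType) (m k : nat)
    (A : pred Z) (Q : pred 'I_m) (u : Z -> 'I_m -> 'rV[K]_k) (S : Z -> 'M[K]_k) :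
    (forall z, A z -> exists2 i, Q i & ~~ (u z i <= S z)%MS) ->
  exists2 c : 'I_m -> K, (forall i, ~~ Q i -> c i = 0)
    & forall z, A z -> ~~ ((\sum_i c i *: u z i)%R <= S z)%MS.
Proof.
move=> outside; pose c (x : K) i : K := if Q i then x ^+ i else 0.
have /fin_all_exists2 [R R_neq0 RP] z : exists2 R : {poly K}, R != 0
    & A z -> forall x, R.[x] != 0 -> ~~ ((\sum_i c x i *: u z i)%R <= S z)%MS.
  have [Az|_] := boolP (A z); last by exists 1; rewrite ?oner_neq0.
  have [i Qi] := outside z Az; rewrite submxE => /rV0Pn [j nz].
  exists (\sum_i (if Q i then (u z i *m cokermx (S z)) 0 j else 0) *: 'X^i).
    apply: contraNneq nz => /(congr1 (fun p : {poly K} => p`_i)).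
    by rewrite coef0 coef_sum_ord Qi => ->.
  move=> _ x; apply: contraNN; rewrite submxE => /eqP.
  move/(congr1 (fun B : 'rV_k => B 0 j)); rewrite [RHS]mxE => eq0.
  apply/eqP; rewrite -[RHS]eq0 mulmx_suml summxE horner_sum; apply: eq_bigr => l _.
  rewrite hornerZ hornerXn -scalemxAl [RHS]mxE /c.
  by case: ifP => _; rewrite ?mul0r // mulrC.
have : \prod_z R z != 0 by apply/prodf_neq0.
case/closed_nonrootP => x; rewrite /root horner_prod => /prodf_neq0 x_ok.
exists (c x) => [i /negPf|z Az]; first by rewrite /c => ->.
by apply: RP => //; exact: x_ok.
Qed.

Lemma rank_sum_rows_leq (K : fieldType) (k : nat) (J : finType) (A : pred J) (B : J -> 'rV[K]_k) :
  (\rank (\sum_(i | A i) <<B i>>)%MS <= #|A|)%N.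
Proof.
rewrite -sum1_card; elim/big_rec2: _ => [|i s D Ai le_Ds]; first by rewrite mxrank0.
apply: leq_trans (mxrank_adds_leqif _ _) _; rewrite mxrank_gen leq_add //.
exact: rank_leq_row.
Qed.

(** The [j]-th combination, for [r <= j < m], has to increase a rank that is at
    least [j + 1]. The [m - 1 - j] rows [B z i] with [i > j] are too few to fill the
    whole space of dimension [m + 1], so one with [i <= j] is available at each
    [z], and a generic combination of these serves all [z]. *)
Lemma generic_completion (K : closedFieldType) (Z : finType) (m r : nat)
    (T : Z -> 'M[K]_m.+1) (B : Z -> 'I_m -> 'rV[K]_m.+1) :
    (r <= m)%N -> (forall z, r < \rank (T z))%N ->
    (forall z, row_full (T z + \sum_i <<B z i>>)%MS) ->
  exists2 c : 'I_m -> 'I_m -> K, (forall j i : 'I_m, (j < i)%N -> c j i = 0)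
    & forall z, row_full (T z + \sum_(j < m | (r <= j)%N) <<(\sum_i c j i *: B z i)%R>>)%MS.
Proof.
move=> le_rm rT full.
pose span (c : 'I_m -> 'I_m -> K) n z :=
  (T z + \sum_(j < m | (r <= j < n)%N) <<(\sum_i c j i *: B z i)%R>>)%MS.
suff stage n : (n <= m)%N -> (r <= n)%N ->
    exists2 c : 'I_m -> 'I_m -> K, (forall j i : 'I_m, (j < i)%N -> c j i = 0)
      & forall z, (n < \rank (span c n z))%N.
  have [c c0 rk] := stage m (leqnn m) le_rm; exists c => // z.
  rewrite -col_leq_rank; apply: leq_trans (rk z) _.
  rewrite /span (eq_bigl (fun j : 'I_m => r <= j)%N) // => j.
  by rewrite ltn_ord andbT.
elim: n => [|n IH] len; rewrite leq_eqVlt => /predU1P [rn|ltr].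
- exists (fun _ _ => 0) => // z.
  by rewrite (leq_trans _ (mxrankS (addsmxSl _ _))) // -rn.
- by [].
- exists (fun _ _ => 0) => // z.
  by rewrite (leq_trans _ (mxrankS (addsmxSl _ _))) // -rn.
have [c c0 rk] := IH (ltnW len) ltr; pose n' := Ordinal len.
have [z /eqP rkz|b b0 outside] := @generic_combination K Z m m.+1
    (fun z => \rank (span c n z) == n.+1) (fun i => i <= n)%N B (span c n).
  have /existsP [i /andP[]] : [exists i : 'I_m, (i <= n)%N && ~~ (B z i <= span c n z)%MS].
    apply: contraT => /existsPn inside.
    have : (m.+1 <= \rank (span c n z + \sum_(i < m | (n < i)%N) <<B z i>>)%MS)%N.
      rewrite -{1}(eqP (full z)) mxrankS // addsmx_sub (submx_trans _ (addsmxSl _ _)) ?addsmxSl //=.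
      apply/sumsmx_subP => i _; rewrite genmxE.
      have [le_in|lt_ni] := leqP i n.
        apply: submx_trans (addsmxSl _ _); move: (inside i).
        by rewrite [(i <= n)%N]le_in /= negbK.
      apply: submx_trans (addsmxSr _ _); rewrite -(genmxE (B z i)).
      exact: (sumsmx_sup i).
    apply: contraLR => _; rewrite -ltnNge; apply: leq_ltn_trans (mxrank_adds_leqif _ _) _.
    rewrite rkz; apply: leq_ltn_trans (leq_add (leqnn _) (rank_sum_rows_leq _ _)) _.
    have -> : (#|(fun i : 'I_m => n < i)%N| = m - n.+1)%N.
      rewrite -sum1_card -(big_geq_mkord n.+1 m predT (fun=> 1%N)).
      by rewrite sum_nat_const_nat muln1.
    by rewrite addSn ltnS; lia.
  by exists i.
exists (fun j => if j == n' then b else c j) => [j i lt_ji|z].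
  case: eqP lt_ji => [-> lt_ni|_ /c0 //]; apply: b0.
  by rewrite -ltnNge.
set c' := fun j => if j == n' then b else c j.
have le_span : (span c n z <= span c' n.+1 z)%MS.
  rewrite addsmx_sub addsmxSl; apply: submx_trans (addsmxSr _ _).
  apply/sumsmx_subP => j /andP[rj jn]; apply: (sumsmx_sup j); first by rewrite rj ltnW.
  by rewrite /c' -val_eqE /= ltn_eqF.
have [/eqP rkz|ne] := eqVneq (\rank (span c n z)) n.+1; last first.
  by apply: leq_trans (mxrankS le_span); rewrite ltn_neqAle eq_sym ne; exact: rk.
apply: leq_ltn_trans (rk z) (rank_ltmx _); rewrite ltmxE le_span /=.
apply: contra (outside z rkz) => /(submx_trans _); apply.
apply: submx_trans (addsmxSr _ _); apply: (sumsmx_sup n'); first by rewrite -ltnS ltr /=.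
by rewrite /c' eqxx genmxE.
Qed.

(** * Points of a reduced complete intersection *)

Definition linear_form (R : comNzRingType) (k : nat) (y : 'rV[R]_k) : {mpoly R[k]} :=
  \sum_i y 0 i *: 'X_i.

Section LinearForms.

Variables (R : comNzRingType) (k : nat).
Implicit Types (x y : 'rV[R]_k) (p : {mpoly R[k]}).

Lemma evalpt_linear_form x y : evalpt x (linear_form y) = \sum_i y 0 i * x 0 i.
Proof.
rewrite /evalpt /linear_form raddf_sum; apply: eq_bigr => i _ /=.
by rewrite mevalZ mevalXU.
Qed.

Lemma gradientZ x c p : gradient x (c *: p) = c *: gradient x p.
Proof. by apply/rowP => j; rewrite !mxE mderivZ /evalpt mevalZ. Qed.

Lemma gradientB x p q : gradient x (p - q) = gradient x p - gradient x q.
Proof. by apply/rowP => j; rewrite !mxE mderivB /evalpt mevalB. Qed.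

Lemma gradient_linear_form x y : gradient x (linear_form y) = y.
Proof.
rewrite /linear_form gradient_sum [RHS]row_sum_delta; apply: eq_bigr => i _.
by rewrite gradientZ gradientX.
Qed.

Lemma linear_form_hom y : linear_form y \is 1.-homog.
Proof.
by apply: rpred_sum => i _; apply: rpredZ; rewrite dhomogX; apply/eqP/mdeg1.
Qed.

Lemma evalpt_scale t c x p : p \is t.-homog -> evalpt (c *: x) p = c ^+ t * evalpt x p.
Proof.
move=> /dhomogP p_hom; rewrite /evalpt !mevalE mulr_sumr big_seq [RHS]big_seq.
apply: eq_bigr => m /p_hom; rewrite /= mdegE => <-; rewrite mulrCA; congr (_ * _).
rewrite -prodrXr -big_split; apply: eq_bigr => i _ /=.
by rewrite mxE exprMn.
Qed.

Lemma dhomog_bigprod (J : finType) (A : pred J) (p : J -> {mpoly R[k]}) (a : J -> nat) :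
    (forall j, A j -> p j \is (a j).-homog) ->
  \prod_(j | A j) p j \is (\sum_(j | A j) a j).-homog.
Proof.
move=> pa; elim/big_rec2: _ => [|j s q Aj q_hom]; first exact: dhomog1.
by apply: dhomogM => //; exact: pa.
Qed.

End LinearForms.

Section CompleteIntersection.

Variables (K : closedFieldType) (m n : nat) (d : 'I_m -> nat).
Variables (f : 'I_m -> {mpoly K[m.+1]}) (a : 'rV[K]_m.+1) (w : 'I_n -> 'rV[K]_m.+1).
Hypothesis d_gt1 : forall i, (1 < d i)%N.
Hypothesis d_mono : forall i j : 'I_m, (i <= j)%N -> (d i <= d j)%N.
Hypothesis f_hom : forall i, f i \is (d i).-homog.
Hypothesis f_reg : regular_seq f.
Hypothesis f_rad : generates_radical f.
Hypothesis w_inj : injective w.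
Hypothesis w_zero : forall j i, evalpt (w j) (f i) = 0.
Hypothesis zero_w : forall x : 'rV[K]_m.+1, x != 0 ->
  (forall i, evalpt x (f i) = 0) -> exists c j, x = c *: w j.
(** The representatives are normalized by a linear form with no zero on [X]. *)
Hypothesis w_norm : forall j, evalpt (w j) (linear_form a) = 1.

Let d_gt0 i : (0 < d i)%N. Proof. exact: ltnW. Qed.

Lemma positive_form_in_ideal t p : (0 < t)%N -> p \is t.-homog ->
  (forall j, evalpt (w j) p = 0) -> in_ideal predT f p.
Proof.
move=> t_gt0 p_hom p_w.
have [|e] := homogeneous_nullstellensatz f_reg f_hom p_hom t_gt0; last exact: f_rad.
move=> x fx; pose y := \row_i x i.
have yE q : q.@[x] = evalpt y q by apply: meval_eq => i; rewrite mxE.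
rewrite yE; have [y0|/zero_w] := eqVneq y 0.
  by rewrite y0 -(scale0r 0) (evalpt_scale _ _ p_hom) expr0n eqn0Ngt t_gt0 mul0r.
case=> [i|c [j ->]]; first by rewrite -yE.
by rewrite (evalpt_scale _ _ p_hom) p_w mulr0.
Qed.

(** If [X] were empty the ideal would contain the variables, but it has no
    element of degree [1]. *)
Lemma points_gt0 : (0 < n)%N.
Proof.
rewrite lt0n; apply/eqP => n0.
have X_hom : ('X_ord0 : {mpoly K[m.+1]}) \is 1.-homog by rewrite dhomogX; apply/eqP/mdeg1.
have idX : in_ideal predT f 'X_ord0.
  by apply: (positive_form_in_ideal _ X_hom) => // -[j lt_jn]; exfalso; rewrite n0 in lt_jn.
have [h X0 hP] := in_ideal_dhomog f_hom X_hom idX.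
have : ('X_ord0 : {mpoly K[m.+1]}) != 0 by rewrite -msize_poly_eq0 msizeX.
rewrite X0 big1 ?eqxx // => i _.
by rewrite (proj2 (hP i)) ?mulr0.
Qed.

Lemma form_in_ideal t p : p \is t.-homog ->
  (forall j, evalpt (w j) p = 0) -> in_ideal predT f p.
Proof.
case: t => [|t] p_hom p_w; last first.
  exact: positive_form_in_ideal (ltn0Sn t) p_hom p_w.
have p_size : (msize p <= 1)%N by exact: msize_dhomog.
have := p_w (Ordinal points_gt0); rewrite (msize1_polyC p_size) /evalpt mevalC => ->.
by rewrite mpolyC0; exact: in_ideal0.
Qed.

Lemma card_points_geq : (\prod_i d i <= n)%N.
Proof. exact: complete_intersection_points_geq form_in_ideal. Qed.

(** The linear form [X_c - (w i)_c * a] vanishes at [w i] as [a] takes the value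
    [1] there; for a coordinate [c] where [w i] and [w j] differ, it does not vanish
    at [w j]. *)
Lemma separating_forms : exists2 G : 'I_n -> {mpoly K[m.+1]},
  forall j, G j \is (\sum_(i < n | i != j) 1).-homog
  & forall i j, (evalpt (w j) (G i) == 0) = (i != j).
Proof.
have /fin_all_exists [c cP] (ij : 'I_n * 'I_n) :
    exists c : 'I_m.+1, ij.1 != ij.2 -> w ij.1 0 c != w ij.2 0 c.
  have [->|nij] := eqVneq ij.1 ij.2; first by exists ord0.
  have /rV0Pn [c nz] : w ij.1 - w ij.2 != 0 by rewrite subr_eq0 (inj_eq w_inj).
  by exists c => _; move: nz; rewrite !mxE subr_eq0.
pose g i j : {mpoly K[m.+1]} := 'X_(c (i, j)) - w i 0 (c (i, j)) *: linear_form a.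
have gE i j l : evalpt (w l) (g i j) = w l 0 (c (i, j)) - w i 0 (c (i, j)).
  by rewrite /evalpt mevalB mevalXU mevalZ [X in _ * X]w_norm mulr1.
exists (fun j => \prod_(i < n | i != j) g i j) => [j|j l].
  apply: dhomog_bigprod => i _; rewrite rpredB ?rpredZ ?linear_form_hom //.
  by rewrite dhomogX; apply/eqP/mdeg1.
rewrite /evalpt rmorph_prod /=; have [->|njl] /= := eqVneq j l.
  apply/negbTE/prodf_neq0 => i nil; rewrite [X in X != 0]gE subr_eq0 eq_sym.
  exact: cP (i, l) nil.
apply/prodf_eq0; exists l; first by rewrite eq_sym.
by rewrite [X in X == 0]gE subrr.
Qed.

(** A linear form vanishing at [w j], multiplied by a form that separates [w j]
    from the other points, is in the ideal: its gradient at [w j] is therefore a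
    combination of those of the [f_i]. *)
Lemma gradients_span j : row_full (<<a>> + \sum_i <<gradient (w j) (f i)>>)%MS.
Proof.
have [G G_hom GP] := separating_forms.
rewrite -sub1mx; apply/row_subP => l; set y := row l _.
pose y' := y - evalpt (w j) (linear_form y) *: a.
have -> : y = evalpt (w j) (linear_form y) *: a + y' by rewrite addrC subrK.
apply: addmx_sub_adds; first by rewrite scalemx_sub ?genmxE.
have y'E : linear_form y' = linear_form y - evalpt (w j) (linear_form y) *: linear_form a.
  rewrite /linear_form scaler_sumr -sumrB; apply: eq_bigr => i _.
  by rewrite !mxE scalerBl scalerA.
have y'_w : evalpt (w j) (linear_form y') = 0.
  by rewrite y'E {1}/evalpt mevalB mevalZ -!/(evalpt _ _) w_norm mulr1 subrr.
have [||h hE] := @positive_form_in_ideal _ (linear_form y' * G j) _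
    (dhomogM (linear_form_hom y') (G_hom j)).
- by rewrite addn_gt0.
- move=> i; rewrite evalptM; have [->|nij] := eqVneq i j; first by rewrite y'_w mul0r.
  by apply/eqP; rewrite mulf_eq0 GP [j == i]eq_sym nij orbT.
have := congr1 (gradient (w j)) hE.
rewrite gradientM gradient_linear_form y'_w scale0r addr0 gradient_sum => grad.
rewrite -(scale1r y') -(@mulVf _ (evalpt (w j) (G j))); last first.
  by rewrite GP eqxx.
rewrite -scalerA grad; apply/scalemx_sub/summx_sub => i _.
rewrite gradientM w_zero scale0r add0r; apply: scalemx_sub.
by apply: (sumsmx_sup i); rewrite ?genmxE.
Qed.

(** At a point of [X] in the linear space, the gradients of [a] and of the [r]
    given linear forms are completed to a basis by those of [m - r] of the [f_i].
    Generic combinations of the [f_i] do this at all the points at once. The [j]-th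
    one only involves the [f_i] with [i <= j], whose degrees are at most [d j], and
    powers of [a] make it homogeneous of degree [d j]. The points are then
    nonsingular zeros of these equations and of [a - 1]. *)
Lemma card_linear_section (r : nat) (y : 'I_m -> 'rV[K]_m.+1) : (r <= m)%N ->
    \rank (\sum_(l < m | (l < r)%N) <<y l>>)%MS = r ->
  (#|[set j | [forall l : 'I_m, (l < r)%N ==> (evalpt (w j) (linear_form (y l)) == 0%R)]]|
     <= \prod_(i < m | (r <= i)%N) d i)%N.
Proof.
move=> le_rm rk_y; set X' := [set j | _].
have X'P (z : {j | j \in X'}) (l : 'I_m) : (l < r)%N ->
    evalpt (w (val z)) (linear_form (y l)) = 0.
  move=> lt_lr; have := valP z; rewrite inE => /forallP /(_ l).
  by rewrite lt_lr => /eqP.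
pose T (z : {j | j \in X'}) := (<<a>> + \sum_(l < m | (l < r)%N) <<y l>>)%MS.
have rT z : (r < \rank (T z))%N.
  rewrite -{1}rk_y; apply: rank_ltmx; rewrite ltmxE addsmxSr addsmx_sub genmxE submx_refl andbT.
  apply/negP => /sub_sumsmxP [u aE].
  have := w_norm (val z); rewrite evalpt_linear_form.
  have -> : \sum_i a 0 i * w (val z) 0 i = (a *m (w (val z))^T) 0 0.
    by rewrite mxE; apply: eq_bigr => i _; rewrite [in RHS]mxE.
  rewrite aE mulmx_suml summxE big1 => [/eqP|l lt_lr]; first by rewrite eq_sym oner_eq0.
  have : (u l *m <<y l>> <= y l)%MS by rewrite -(genmxE (y l)) submxMl.
  case/sub_rVP => b ->; rewrite -scalemxAl mxE [X in _ * X]mxE.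
  have := X'P z l lt_lr; rewrite evalpt_linear_form => yw.
  rewrite (eq_bigr (fun i => y l 0 i * w (val z) 0 i)) ?yw ?mulr0 // => i _.
  by rewrite [X in _ * X = _]mxE.
have full z : row_full (T z + \sum_i <<gradient (w (val z)) (f i)>>)%MS.
  rewrite -sub1mx; apply: submx_trans (_ : <<a>> + \sum_i <<gradient (w (val z)) (f i)>> <= _)%MS.
    by rewrite sub1mx gradients_span.
  by rewrite addsmxS // addsmxSl.
have [c c_low c_full] := generic_completion le_rm rT full.
pose g j := \sum_i c j i *: (linear_form a ^+ (d j - d i) * f i).
pose F (l : 'I_m.+1) : {mpoly K[m.+1]} :=
  if unlift ord0 l is Some j then if (j < r)%N then linear_form (y j) else g j
  else linear_form a - 1.
pose e (l : 'I_m.+1) : nat :=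
  if unlift ord0 l is Some j then if (j < r)%N then 1 else d j else 1.
have -> : (\prod_(i < m | (r <= i)%N) d i = \prod_l e l)%N.
  rewrite big_ord_recl /e unlift_none mul1n big_mkcond; apply: eq_bigr => i _.
  by rewrite liftK leqNgt; case: (i < r)%N.
have [G G_hom GP] := separating_forms.
have -> : #|X'| = #|{: {j | j \in X'}}| by rewrite card_sig.
apply: (@card_nonsingular_zeros _ _ _ (fun z => w (val z)) e F n (fun z => G (val z))).
- by move=> l; rewrite /e; case: unlift => // j; case: ifP.
- move=> l; rewrite /e /F; case: unlift => [j|].
    case: ifP => _; first exact: msize_dhomog (linear_form_hom _).
    apply: msize_dhomog; apply: rpred_sum => i _.
    have [le_ij|/c_low ->] := leqP i j; last by rewrite scale0r dhomog0.
    apply: rpredZ; rewrite -{2}(subnK (d_mono le_ij)).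
    by apply: dhomogM => //; rewrite -{2}(mul1n (d j - d i)%N); exact/dhomogMn/linear_form_hom.
  rewrite (leq_trans (mmeasureD_le _ _ _)) // geq_max mmeasureN msize1 andbT.
  exact: msize_dhomog (linear_form_hom _).
- move=> z l; rewrite /F; case: unlift => [j|]; last first.
    by rewrite /evalpt mevalB meval1 [X in X - _]w_norm subrr.
  case: ifP => [/X'P|_] //; rewrite /evalpt /g raddf_sum big1 //= => i _.
  by rewrite mevalZ mevalM [X in _ * (_ * X)]w_zero !mulr0.
- move=> z; rewrite -row_full_unit -sub1mx; set J := \matrix_l _.
  apply: submx_trans (_ : T z + \sum_(j < m | (r <= j)%N)
      <<(\sum_i c j i *: gradient (w (val z)) (f i))%R>> <= _)%MS.
    by rewrite sub1mx c_full.
  have rowJ l : (gradient (w (val z)) (F l) <= J)%MS.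
    by rewrite (_ : gradient _ _ = row l J) ?row_sub // rowK.
  have grad_norm : gradient (w (val z)) (linear_form a - 1) = a.
    by rewrite gradientB gradient_linear_form -mpolyC1 gradientC subr0.
  rewrite !addsmx_sub genmxE -{1}grad_norm.
  apply/andP; split; first (apply/andP; split).
  + by have := rowJ ord0; rewrite /F unlift_none.
  + apply/sumsmx_subP => l lt_lr; rewrite genmxE.
    by have := rowJ (lift ord0 l); rewrite /F liftK lt_lr gradient_linear_form.
  + apply/sumsmx_subP => j le_rj; rewrite genmxE.
    have := rowJ (lift ord0 j); rewrite /F liftK ltnNge le_rj /=.
    suff -> : gradient (w (val z)) (g j) = \sum_i c j i *: gradient (w (val z)) (f i) by [].
    rewrite /g gradient_sum; apply: eq_bigr => i _.
    rewrite gradientZ gradientM w_zero scale0r add0r.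
    by rewrite /evalpt rmorphXn /= [X in X ^+ _]w_norm expr1n scale1r.
- move=> z; rewrite (leq_trans (msize_dhomog (G_hom _))) // ltnS sum1_card.
  by rewrite (leq_trans (max_card _)) // card_ord.
- by move=> z z'; rewrite GP (inj_eq val_inj).
Qed.

End CompleteIntersection.

(** * The code *)

Lemma map_mpoly_dhomog (F K : fieldType) (iota : {rmorphism F -> K}) (k t : nat)
    (p : {mpoly F[k]}) :
  p \is t.-homog -> map_mpoly iota p \is t.-homog.
Proof.
move=> /dhomogP p_hom; apply/dhomogP => b; rewrite mcoeff_msupp mcoeff_map_mpoly.
by rewrite fmorph_eq0 -mcoeff_msupp; exact: p_hom.
Qed.

Lemma evalpt_form1 (R : comNzRingType) (k : nat) (p : {mpoly R[k]}) (x : 'rV[R]_k) :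
  p \is 1.-homog -> evalpt x p = \sum_i p@_U_(i) * x 0 i.
Proof.
move=> p_hom; suff {1}-> : p = linear_form (\row_i p@_U_(i)).
  by rewrite evalpt_linear_form; apply: eq_bigr => i _; rewrite mxE.
apply/mpolyP => b; rewrite /linear_form raddf_sum /=.
under eq_bigr => i _ do rewrite mxE mcoeffZ mcoeffX.
have [|nb] := boolP (mdeg b == 1%N).
  case/mdeg1P => j /eqP ->; rewrite (bigD1 j) //= eqxx mulr1 big1 ?addr0 // => i ni.
  by rewrite eq_mnm1 (negPf ni) mulr0.
rewrite (dhomog_nemf_coeff p_hom nb) big1 // => i _.
have [eib|_] := eqVneq U_(i)%MM b; last by rewrite mulr0.
by move: nb; rewrite -eib mdeg1 eqxx.
Qed.

(** The evaluations of the rows of [Y] are a basis of [D], which makes these linear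
    forms independent. *)
Lemma subcode_linear_forms (F : finFieldType) (k n : nat) (v : 'I_n -> 'rV[F]_k)
    (C D : {vspace 'rV[F]_n}) : linear_forms_code v C -> (D <= C)%VS ->
  exists2 Y : 'M[F]_(\dim D, k), row_free Y
    & forall l, exists2 c : 'rV[F]_n, c \in D &
        forall j, c 0 j = \sum_i Y l i * v j 0 i.
Proof.
move=> codeC subDC.
have /fin_all_exists2 [p p_hom pE] (l : 'I_(\dim D)) :
    exists2 p : {mpoly F[k]}, p \is 1.-homog & (vbasis D)`_l = \row_j evalpt (v j) p.
  by apply/codeC/(subvP subDC)/vbasis_mem/memt_nth.
pose Y := \matrix_(l, i) (p l)@_U_(i).
have YE (l : 'I_(\dim D)) j : (vbasis D)`_l 0 j = \sum_i Y l i * v j 0 i.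
  by rewrite pE mxE evalpt_form1 //; apply: eq_bigr => i _; rewrite mxE.
exists Y => [|l]; last by exists (vbasis D)`_l => //; apply/vbasis_mem/memt_nth.
apply: inj_row_free => u uY0.
have /freeP basis_free := basis_free (vbasisP D).
apply/rowP => l; rewrite mxE; apply: (basis_free (u 0)).
apply/rowP => j; rewrite summxE mxE.
under eq_bigr => l' _ do rewrite mxE YE mulr_sumr.
rewrite exchange_big big1 //= => i _.
under eq_bigr => l' _ do rewrite mulrA.
rewrite -mulr_suml; have := congr1 (fun B : 'rV_k => B 0 i) uY0.
by rewrite !mxE => ->; rewrite mul0r.
Qed.

Lemma ghw_geq (F : finFieldType) (n r b : nat) (C : {vspace 'rV[F]_n}) :
    (b <= n)%N ->
    (forall D : {vspace 'rV[F]_n}, (D <= C)%VS -> \dim D = r -> b <= #|supp D|)%N ->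
  (b <= ghw C r)%N.
Proof.
move=> bn bD; rewrite /ghw; elim/big_rec: _ => // D x /andP[DC /eqP dD] bx.
by rewrite leq_min bD.
Qed.

Theorem theorem2p5 (F : finFieldType) (K : closedFieldType)
    (iota : {rmorphism F -> K}) (hK : is_algebraic_closure iota)
    (k : nat) (hk : (2 <= k)%N)
    (d : 'I_k.-1 -> nat)
    (hd2 : forall i : 'I_k.-1, (2 <= d i)%N)
    (hdmono : forall i j : 'I_k.-1, (i <= j)%N -> (d i <= d j)%N)
    (n : nat) (v : 'I_n -> 'rV[F]_k)
    (hv : distinct_points v)
    (hX : reduced_complete_intersection iota d v)
    (C : {vspace 'rV[F]_n}) (hC : linear_forms_code v C)
    (hdim : \dim C = k)
    (r : nat) (hr1 : (1 <= r)%N) (hrk : (r <= k.-1)%N) :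
  (((\prod_(i < k.-1 | (i < r)%N) d i) - 1)
     * \prod_(i < k.-1 | (r <= i)%N) d i <= ghw C r)%N.
Proof.
case: k hk d hd2 hdmono v hv hX C hC hdim hrk => // m _ d hd2 hdmono v.
case=> v0 v_distinct hX C hC _ hrk.
case: hX => f /= [f_hom f_reg f_rad zeroX].
pose fK i := map_mpoly iota (f i).
pose vK j := map_mx iota (v j).
have vK0 j : vK j != 0 by rewrite map_mx_eq0.
have [c _ c_norm] : exists2 c : 'I_m.+1 -> K, (forall i, ~~ predT i -> c i = 0)
    & forall j, predT j -> ~~ ((\sum_i c i *: (vK j 0 i)%:M)%R <= (0 : 'M[K]_1))%MS.
  apply: (generic_combination (u := fun j i => (vK j 0 i)%:M)) => j _.
  have /rV0Pn [i vji] := vK0 j; exists i => //.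
  rewrite submx0; apply: contraNneq vji => /(congr1 (fun B : 'M_1 => B 0 0)).
  by rewrite !mxE eqxx mulr1n => ->.
pose a := \row_i c i.
have a_v j : evalpt (vK j) (linear_form a) != 0.
  move: (c_norm j isT); rewrite submx0; apply: contraNneq => av0.
  apply/eqP/matrixP => s t; rewrite !ord1 summxE [RHS]mxE -[RHS]av0 evalpt_linear_form.
  by apply: eq_bigr => i _; rewrite !mxE eqxx mulr1n.
pose s j := (evalpt (vK j) (linear_form a))^-1.
have s0 j : s j != 0 by rewrite invr_eq0.
pose w j := s j *: vK j.
have w_norm j : evalpt (w j) (linear_form a) = 1.
  by rewrite (evalpt_scale _ _ (linear_form_hom a)) expr1 mulVf.
have w_inj : injective w.
  move=> i j wij; apply: v_distinct.
  have [l vjl] : exists l, v j 0 l != 0 by apply/rV0Pn.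
  have vK_ij : vK i = ((s i)^-1 * s j) *: vK j.
    by rewrite -scalerA -[s j *: _]wij scalerA mulVf ?scale1r.
  have sE : (s i)^-1 * s j = iota (v i 0 l / v j 0 l).
    have := congr1 (fun B : 'rV_m.+1 => B 0 l) vK_ij; rewrite !mxE => eqv.
    by rewrite fmorph_div eqv mulfK // fmorph_eq0.
  exists (v i 0 l / v j 0 l).
    by rewrite -(fmorph_eq0 iota) -sE mulf_neq0 // invr_eq0.
  by apply: (map_mx_inj (f := iota)); rewrite map_mxZ -sE; exact: vK_ij.
have fK_hom i : fK i \is (d i).-homog by exact/map_mpoly_dhomog/f_hom.
have w_zero j i : evalpt (w j) (fK i) = 0.
  rewrite (evalpt_scale _ _ (fK_hom i)).
  have -> : evalpt (vK j) (fK i) = 0; last by rewrite mulr0.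
  by apply: (proj2 (zeroX (vK j) (vK0 j))); exists j, 1; rewrite ?oner_neq0 ?scale1r.
have zero_w x : x != 0 -> (forall i, evalpt x (fK i) = 0) -> exists c j, x = c *: w j.
  move=> x0 /(proj1 (zeroX x x0)) [j [b _ ->]]; exists (b / s j), j.
  by rewrite scalerA divfK.
have n_geq : (\prod_i d i <= n)%N.
  exact: card_points_geq hd2 fK_hom f_reg f_rad zero_w.
rewrite /= in hrk *; pose Dr := (\prod_(i < m | (i < r)%N) d i)%N.
have prodE : (Dr * \prod_(i < m | (r <= i)%N) d i <= n)%N.
  rewrite (leq_trans _ n_geq) // [leqRHS](bigID (fun i : 'I_m => i < r)%N) /=.
  by under [X in (_ <= _ * X)%N]eq_bigl => i do rewrite -leqNgt.
apply: ghw_geq => [|D DC dimD].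
  by apply: leq_trans prodE; rewrite leq_mul2r leq_subr orbT.
have [Y Y_free YD] := subcode_linear_forms hC DC.
rewrite dimD in Y Y_free YD.
pose y (l : 'I_m) := if insub (l : nat) is Some l' then row (l' : 'I_r) (map_mx iota Y) else 0.
have y_rank : \rank (\sum_(l < m | (l < r)%N) <<y l>>)%MS = r.
  have YK_free : row_free (map_mx iota Y) by rewrite row_free_map.
  rewrite -[RHS](eqP YK_free); apply/eqmx_rank/andP; split.
    apply/sumsmx_subP => l lt_lr; by rewrite genmxE /y insubT row_sub.
  apply/row_subP => l; have lt_lm : (l < m)%N := leq_trans (ltn_ord l) hrk.
  apply: (sumsmx_sup (Ordinal lt_lm)) => //=; rewrite genmxE /y /=.
  by rewrite valK.
have := card_linear_section hd2 hdmono fK_hom f_reg f_rad w_inj w_zero zero_w w_norm hrk y_rank.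
set X' := [set j | _] => card_X'.
have compl_supp : (#|~: supp D| <= #|X'|)%N.
  apply/subset_leq_card/subsetP => j; rewrite !inE negb_exists => /forallP Dj.
  apply/forallP => l; apply/implyP => lt_lr.
  rewrite (evalpt_scale _ _ (linear_form_hom _)) mulf_eq0; apply/orP; right.
  have [b Db bE] := YD (Ordinal lt_lr).
  have b0 : b 0 j = 0 by move: (Dj b); rewrite Db /= negbK => /eqP.
  rewrite evalpt_linear_form; suff -> : \sum_i y l 0 i * vK j 0 i = iota (b 0 j).
    by rewrite b0 rmorph0.
  rewrite bE rmorph_sum; apply: eq_bigr => i _.
  by rewrite /y insubT !mxE rmorphM.
rewrite mulnBl mul1n leq_subLR; apply: leq_trans prodE _.
rewrite -[leqLHS]card_ord -(cardsC (supp D)) addnC leq_add2r.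
exact: leq_trans compl_supp card_X'.
Qed.
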